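(* Let $d\in\mathbb{N}$, let $L\in\mathbb{N}$ with $L\ge d$, and let $A(L,d)$ be the randomized Smolyak method of level $L$ built from building blocks $U^{(n)}_l$ ($n=1,\dots,d$, $l\in\mathbb{N}$) approximating $S^{(n)}:F^{(n)}\to G^{(n)}$. Let $\mathrm{x}\in\{\mathrm{r},\mathrm{w}\}$. Assume that there are constants $B,C,E>0$ and $D\in(0,1)$ such that for all $n=1,\dots,d$ and all $l\in\mathbb{N}$ $$\|S^{(n)}\|_{\mathrm{op}}\le B,\qquad e^{\mathrm{x}}(S^{(n)},U^{(n)}_l)\le C D^l .$$ If $\mathrm{x}=\mathrm{r}$, assume additionally that for all $n=1,\dots,d$, $l\in\mathbb{N}$: $U^{(n)}_lf\in L^2(\Omega^{(n)},G^{(n)})$ for all $f\in F^{(n)}$, and $$\sup_{\|f\|_{F^{(n)}}\le 1}\mathbb{E}\big[\|U^{(n)}_lf-U^{(n)}_{l-1}f\|^2\big]^{1/2}\le E D^l .$$ If $\mathrm{x}=\mathrm{w}$, assume additionally that for all $n=1,\dots,d$, $l\in\mathbb{N}$: $\mu_{l,n}(\omega_n):=\sup_{\|f\|_{F^{(n)}}\le1}\|(U^{(n)}_lf)(\omega_n)\|<\infty$ for all $\omega_n\in\Omega^{(n)}$, $\mu_{l,n}$ is measurable with $\|\mu_{l,n}\|_{L^2(\Omega^{(n)},\mathbb{R})}<\infty$, and $$\mathbb{E}\Big[\sup_{\|f\|_{F^{(n)}}\le 1}\|U^{(n)}_lf-U^{(n)}_{l-1}f\|^2\Big]^{1/2}\le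 E D^l .$$ Then $$e^{\mathrm{x}}(S_d,A(L,d))\le C B^{d-1}D^{L-d+1}\sum_{j=0}^{d-1}\Big(\frac{ED}{B}\Big)^j\binom{L-d+j}{j}\le C H^{d-1}\binom{L}{d-1}D^L,$$ where $H=\max\{B/D,\,E\}$.
   Context: $\mathbb{N}=\{1,2,\dots\}$. For $n=1,\dots,d$, $F^{(n)}$ is a separable Hilbert space of real-valued functions, $G^{(n)}$ is a separable Hilbert space, and $S^{(n)}:F^{(n)}\to G^{(n)}$ is a continuous linear operator. $F_d=F^{(1)}\otimes\cdots\otimes F^{(d)}$ and $G_d=G^{(1)}\otimes\cdots\otimes G^{(d)}$ are the Hilbert space tensor products and $S_d=S^{(1)}\otimes\cdots\otimes S^{(d)}:F_d\to G_d$. Norms on $G^{(n)}$ and $G_d$ are written $\|\cdot\|$. Randomized linear operator: for separable Hilbert spaces $F,G$ and a probability space $(\Omega,\Sigma,\mathbf{P})$, a map $A:\Omega\to L(F,G)$ (bounded linear operators) such that $\omega\mapsto A(\omega)f$, denoted $Af$, is a random variable with values in $G$ (Borel $\sigma$-field) for every $f\in F$. For a bounded linear $S:F\to G$ its randomized error and (root mean square) worst case error are $$e^{\mathrm r}(S,A)=\sup_{\|f\|_F\le1}\mathbb{E}\big[\|(S-A)f\|^2\big]^{1/2},\qquad e^{\mathrm w}(S,A)=\mathbb{E}\Big[\sup_{\|f\|_F\le1}\|(S-A)f\|^2\Big]^{1/2}.$$ Building blocks: for each $n=1,\dots,d$, $(U^{(n)}_l)_{l\in\mathbb{N}}$ is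 a sequence of randomized linear operators $U^{(n)}_l:\Omega^{(n)}\to L(F^{(n)},G^{(n)})$ on a probability space $(\Omega^{(n)},\Sigma^{(n)},\mathbf{P}^{(n)})$. Put $U^{(n)}_0:=0$ and $\Delta^{(n)}_l:=U^{(n)}_l-U^{(n)}_{l-1}$ for $l\in\mathbb{N}$. Let $(\Omega,\Sigma,\mathbf{P})$ be the product of the spaces $(\Omega^{(n)},\Sigma^{(n)},\mathbf{P}^{(n)})$, $n=1,\dots,d$. For $\mathbf{l}\in\mathbb{N}^d$ write $|\mathbf{l}|=l_1+\dots+l_d$ and $Q(L,d)=\{\mathbf{l}\in\mathbb{N}^d: |\mathbf{l}|\le L\}$. Randomized Smolyak method of level $L\ge d$: the randomized linear operator on $\Omega$ $$A(L,d)(\omega)=\sum_{\mathbf{l}\in Q(L,d)}\bigotimes_{n=1}^d\Delta^{(n)}_{l_n}(\omega_n),\qquad \omega=(\omega_1,\dots,\omega_d)\in\Omega .$$ *)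

(* Defs.v *)
From HB Require Import structures.
From mathcomp Require Import all_boot all_order all_algebra.
From mathcomp Require Import all_classical all_reals all_analysis.
From mathcomp Require Import measurable_realfun.

Set Implicit Arguments.
Unset Strict Implicit.
Unset Printing Implicit Defensive.

Import Order.TTheory GRing.Theory Num.Theory.
Import numFieldNormedType.Exports.

Local Open Scope classical_set_scope.
Local Open Scope ring_scope.

HB.mixin Record CompleteNormedModule_isHilbert (R : realType) V
    of CompleteNormedModule R V := {
  inner : {dot V for @idfun R} ;
  inner_norm : forall x : V, inner x x = `|x| ^+ 2
}.

#[short(type="hilbertType")]
HB.structure Definition Hilbert (R : realType) :=
  { V of CompleteNormedModule R V & CompleteNormedModule_isHilbert R V }.

Definition separable (T : topologicalType) : Prop :=
  exists2 D : set T, countable D & dense D.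

Definition unit_ball (R : realType) (V : normedModType R) : set V :=
  [set f | `|f| <= 1].

Definition bounded_linear (R : realType) (V W : normedModType R) (T : V -> W) :
  Prop := linear T /\ continuous T.

Definition op_norm (R : realType) (V W : normedModType R) (T : V -> W) :
  \bar R := ereal_sup [set `|T f|%:E | f in @unit_ball R V].

Section hilbert_tensor_product.
Variables (R : realType) (d : nat).

(* A Hilbert space tensor product of F 0, ..., F d.-1, given by its
   characterization, which determines it up to a unique isometric isomorphism
   compatible with the elementary tensors.  [dfwith f n x] is the family f with
   its n-th entry replaced by x : F n. *)
Record hilbert_tensor (F : 'I_d -> hilbertType R) := HilbertTensor {
  tensor_space :> hilbertType R ;
  tensor : (forall n, F n) -> tensor_space ;
  tensor_multilinear : forall (f : forall n, F n) (n : 'I_d),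
    linear (fun x : F n => tensor (dfwith f n x)) ;
  tensor_inner : forall f g : forall n, F n,
    inner (tensor f) (tensor g) = \prod_(n < d) inner (f n) (g n) ;
  tensor_dense : dense [set x : tensor_space |
    exists (k : nat) (c : 'I_k -> R) (f : 'I_k -> forall n, F n),
      x = \sum_(i < k) c i *: tensor (f i)]
}.

(* The tensor product of bounded linear operators T n, namely the unique
   bounded linear operator mapping each elementary tensor of (f n) to the
   elementary tensor of (T n (f n)).  The default value 0 is never used when
   every T n is bounded and linear. *)
Definition tensor_op (F G : 'I_d -> hilbertType R)
    (FF : hilbert_tensor F) (GG : hilbert_tensor G)
    (T : forall n, F n -> G n) : FF -> GG :=
  xget (fun=> 0) [set A : FF -> GG | bounded_linear A /\
    forall f : forall n, F n, A (tensor FF f) = tensor GG (fun n => T n (f n))].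

End hilbert_tensor_product.

Arguments tensor_op {R d F G} FF GG T _ : rename.

Definition borel (T : ptopologicalType) := g_sigma_algebraType (@open T).

Section randomized_operators.
Context (R : realType) (dO : measure_display) (Omega : measurableType dO).
Variable P : probability Omega R.

Definition randomized_operator (F G : normedModType R)
    (A : Omega -> F -> G) : Prop :=
  (forall w, bounded_linear (A w)) /\
  (forall f, measurable_fun setT (fun w => A w f : borel G)).

Definition square_integrable (G : normedModType R) (X : Omega -> G) : Prop :=
  measurable_fun setT (X : Omega -> borel G) /\
  (\int[P]_w (`|X w| ^+ 2)%:E < +oo)%E.

(* [randomized] is the error criterion r, [worst_case] the criterion w. *)
Variant error_kind := randomized | worst_case.

(* For F separable and T w continuous and linear, the supremum in the second
   case is also one over a countable set, hence measurable in w. *)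
Definition error_norm (F G : normedModType R) (x : error_kind)
    (T : Omega -> F -> G) : \bar R :=
  match x with
  | randomized =>
      ereal_sup [set ((\int[P]_w (`|T w f| ^+ 2)%:E) `^ 2^-1)%E
                | f in @unit_ball R F]
  | worst_case =>
      ((\int[P]_w ereal_sup [set (`|T w f| ^+ 2)%:E | f in @unit_ball R F])
         `^ 2^-1)%E
  end.

Definition error (F G : normedModType R) (x : error_kind)
    (S : F -> G) (A : Omega -> F -> G) : \bar R :=
  error_norm x (fun w f => S f - A w f).

End randomized_operators.

Section product_probability.
Context (R : realType) (d : nat) (dO : 'I_d -> measure_display).
Variable Omega : forall n, measurableType (dO n).

(* Generators of the product sigma-algebra on the dependent functions. *)
Definition cylinders : set (set (forall n, Omega n)) :=
  [set C | exists n (B : set (Omega n)), measurable B /\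
     C = [set w | B (w n)]].

Definition product_space := g_sigma_algebraType cylinders.

(* The values on boxes determine P, because the boxes form a pi-system that
   generates the product sigma-algebra. *)
Definition is_product_probability (Pn : forall n, probability (Omega n) R)
    (P : probability product_space R) : Prop :=
  forall B : forall n, set (Omega n), (forall n, measurable (B n)) ->
    P [set w : forall n, Omega n | forall n, B n (w n)] =
    (\prod_(n < d) Pn n (B n))%E.

End product_probability.

Section smolyak.
Context (R : realType).

(* [U l] is the building block of index l >= 1; the value [U 0] is ignored
   and replaced by 0. *)
Definition difference (Omega : Type) (F G : normedModType R)
    (U : nat -> Omega -> F -> G) (l : nat) (w : Omega) (f : F) : G :=
  let U0 k := if k is 0 then 0 else U k w f in U0 l - U0 l.-1.

(* Every l in N^d with l 0 + ... + l d.-1 <= L has entries <= L, so that the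
   multi-indices range over a finite type. *)
Definition Qset (L d : nat) : {set {ffun 'I_d -> 'I_L.+1}} :=
  [set l : {ffun 'I_d -> 'I_L.+1} |
    [forall n, (0 < l n)%N] && (\sum_(n < d) l n <= L)%N].

Definition smolyak (d : nat) (F G : 'I_d -> hilbertType R)
    (FF : hilbert_tensor F) (GG : hilbert_tensor G)
    (Omega : 'I_d -> Type) (U : forall n, nat -> Omega n -> F n -> G n)
    (L : nat) (w : forall n, Omega n) (f : FF) : GG :=
  \sum_(l in Qset L d)
    tensor_op FF GG (fun n => difference (U n) (l n) (w n)) f.

End smolyak.

Arguments smolyak {R d F G} FF GG {Omega} U L w f.

(* Main.v *)
Require Import Defs.
From HB Require Import structures.
From mathcomp Require Import all_boot all_order all_algebra.
From mathcomp Require Import all_classical all_reals all_analysis.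
From mathcomp Require Import measurable_realfun ring lra zify.
Import Order.TTheory GRing.Theory Num.Theory.
Import numFieldNormedType.Exports.
Local Open Scope classical_set_scope.
Local Open Scope ring_scope.
Set Implicit Arguments.
Unset Strict Implicit.
Unset Printing Implicit Defensive.

(** The error S_d - A(L, d) is a sum of tensor products of simple operators, and
    an error norm of a tensor product is at most the product of the error norms
    of its factors.

    For the decomposition ([smolyak_errorE], from [smolyak_telescope]), let T_k
    be the sum of the operators with factors Delta_(l_n) for n < k and S^(n) for
    n >= k, over all positive l_0, ..., l_(k-1) of total at most L - d + k.
    Then T_0 = S_d and T_d = A(L, d).  Since the details up to level m add up to
    U_m, the difference T_k - T_(k+1) is the sum over the same indices of the
    tensor products with Delta_(l_n) before k, S^(k) - U^(k)_m with
    m = L - d + k + 1 - |l| in position k, and S^(n) after k.  The factors have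
    error norms at most E D^(l_n), C D^m and B, so every such product is bounded
    by C E^k B^(d-1-k) D^(L-d+k+1), and there are binomial(L-d+k, k) of them
    ([card_prefix_indices]).  The sum over k is the first bound
    ([sum_term_bound]); the second one follows termwise and from the
    hockey-stick identity ([smolyak_bound_le]).

    The submultiplicativity of error norms is [error_norm_tensor_sum].  On a
    combination of elementary tensors with coefficients c, the squared norm of
    the tensor product of operators T_n is a quadratic form in c whose kernel is
    the Hadamard product over n of the Gram kernels of the images.  A bound for
    T_n says that its Gram kernel is dominated by a multiple of the Gram kernel
    of the arguments, and by the Schur product theorem such dominations can be
    multiplied ([quadratic_form_prod_le]).  For deterministic operators this
    shows that the tensor product operator exists and has norm at most the
    product of the norms ([tensor_opP], [tensor_op_norm_le]).  For the worst
    case error this pointwise bound suffices, because the norms of the factors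
    depend on different coordinates and are therefore independent
    ([worst_case_tensor_bound]).  For the randomized error the same argument is
    applied to the expected Gram kernels: by independence the expectation of a
    product of inner products is the product of the expectations
    ([has_integral_prod], [randomized_tensor_bound]).  Finally, both errors are
    subadditive because of the triangle inequality in L2
    ([integral_sqr_sum_le]). *)

(** * Hadamard products of positive semidefinite kernels *)

Section schur_product.
Context {R : realFieldType} {I : finType}.
Implicit Types (K M : I -> I -> R) (c : I -> R).

Definition quadratic_form K c : R := \sum_i \sum_j c i * c j * K i j.

Definition psd K : Prop :=
  (forall i j, K i j = K j i) /\ (forall c, 0 <= quadratic_form K c).

Lemma quadratic_formD K M c :
  quadratic_form (fun i j => K i j + M i j) c =
  quadratic_form K c + quadratic_form M c.
Proof.
rewrite -big_split; apply: eq_bigr => i _; rewrite -big_split.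
by apply: eq_bigr => j _; rewrite mulrDr.
Qed.

Lemma quadratic_form_ZB K M c a :
  quadratic_form (fun i j => a * K i j - M i j) c =
  a * quadratic_form K c - quadratic_form M c.
Proof.
rewrite mulr_sumr -sumrB; apply: eq_bigr => i _.
by rewrite mulr_sumr -sumrB; apply: eq_bigr => j _; rewrite mulrBr mulrCA.
Qed.

Lemma quadratic_form_scale K c v a :
  quadratic_form (fun i j => a * (v i * v j * K i j)) c =
  a * quadratic_form K (fun i => c i * v i).
Proof.
rewrite mulr_sumr; apply: eq_bigr => i _; rewrite mulr_sumr.
by apply: eq_bigr => j _; ring.
Qed.

Lemma quadratic_form_shift K c p t : (forall i j, K i j = K j i) ->
  quadratic_form K (fun i => c i + t * (i == p)%:R) =
  quadratic_form K c + 2 * t * (\sum_i c i * K i p) + t ^+ 2 * K p p.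
Proof.
move=> Ks.
have sum_delta (f : I -> R) : \sum_i (i == p)%:R * f i = f p.
  rewrite (bigD1 p) //= eqxx mul1r big1 ?addr0 // => i /negbTE ->.
  by rewrite mul0r.
transitivity (\sum_i (\sum_j c i * c j * K i j + t * (c i * K i p) +
   (i == p)%:R * (t * (\sum_j c j * K j i) + t ^+ 2 * K i p))).
  apply: eq_bigr => i _.
  transitivity (\sum_j (c i * c j * K i j + (j == p)%:R * (t * c i * K i j) +
    (i == p)%:R * t * (c j * K j i) +
    (j == p)%:R * ((i == p)%:R * t ^+ 2 * K i j))).
    by apply: eq_bigr => j _; rewrite (Ks j i); ring.
  by rewrite !big_split /= !sum_delta -mulr_sumr; ring.
by rewrite !big_split /= sum_delta -mulr_sumr /quadratic_form; ring.
Qed.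

Lemma psd_diag_ge0 K p : psd K -> 0 <= K p p.
Proof.
case=> Ks Kp; have := Kp (fun i => 0 + 1 * (i == p)%:R).
rewrite quadratic_form_shift // /quadratic_form.
under eq_bigr do under eq_bigr do rewrite mul0r mul0r.
under [X in 2 * 1 * X]eq_bigr do rewrite mul0r.
rewrite big1 => [|i _]; last by rewrite big1.
by rewrite big1 // mulr0 !add0r expr1n mul1r.
Qed.

Lemma psd_diag0 K p q : psd K -> K p p = 0 -> K q p = 0.
Proof.
move=> [Ks Kp] Kpp; apply/eqP/negPn/negP => Kqp.
pose c i : R := (i == q)%:R.
have Ec : \sum_i c i * K i p = K q p.
  rewrite (bigD1 q) //= /c eqxx mul1r big1 ?addr0 // => i /negbTE ->.
  by rewrite mul0r.
(* The form is affine in the coefficient of p, and this coefficient makes it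
   equal to -1. *)
have := Kp (fun i =>
  c i + (- (quadratic_form K c + 1) / (2 * K q p)) * (i == p)%:R).
rewrite quadratic_form_shift // Ec Kpp mulr0 addr0.
have -> : 2 * (- (quadratic_form K c + 1) / (2 * K q p)) * K q p =
  - (quadratic_form K c + 1) by field.
lra.
Qed.

(** The form of the Schur complement at c is the minimum of the form of K over
    all changes of the coordinate p of c. *)
Lemma psd_schur_complement K p : psd K -> 0 < K p p ->
  psd (fun i j => K i j + - (K p p)^-1 * (K i p * K j p * 1)).
Proof.
move=> [Ks Kp] Kpp; split=> [i j|c]; first by rewrite (Ks i j); ring.
(* The coefficient of p is the one that minimizes the form. *)
have := Kp (fun i => c i + (- (\sum_i c i * K i p) / K p p) * (i == p)%:R).
rewrite quadratic_form_shift // quadratic_formD quadratic_form_scale.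
set s := \sum_i c i * K i p.
have -> : quadratic_form (fun=> fun=> 1) (fun i => c i * K i p) = s ^+ 2.
  rewrite /quadratic_form expr2 {1}/s mulr_suml.
  apply: eq_bigr => i _; rewrite /s mulr_sumr.
  by apply: eq_bigr => j _; rewrite mulr1.
suff -> : quadratic_form K c + 2 * (- s / K p p) * s +
    (- s / K p p) ^+ 2 * K p p =
   quadratic_form K c + - (K p p)^-1 * s ^+ 2 by [].
by field; rewrite gt_eqF.
Qed.

(** Schur product theorem, by induction on the number of nonzero diagonal
    entries of K.  Subtracting from K the rank one kernel of a column with
    nonzero diagonal entry leaves the Schur complement, which has fewer such
    entries; and the Hadamard product of M with a rank one kernel is M evaluated
    at a rescaled vector. *)
Lemma psd_hadamard K M : psd K -> psd M -> psd (fun i j => K i j * M i j).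
Proof.
have [m] := ubnP #|[pred i | K i i != 0%R]|.
elim: m K => // m IH K Km pK pM; split=> [i j|c].
  by case: pK pM => [-> _] [-> _].
have [/existsP[p Kp]|] := boolP [exists p, K p p != 0]; last first.
  move=> /existsPn K0; rewrite /quadratic_form big1 // => i _.
  rewrite big1 // => j _; have /negPn/eqP Kj := K0 j.
  by rewrite (psd_diag0 i pK Kj) mul0r mulr0.
have Kpp : 0 < K p p by rewrite lt_neqAle eq_sym Kp psd_diag_ge0.
have := psd_schur_complement pK Kpp; set K' := (fun i j => _) => pK'.
have -> : (fun i j => K i j * M i j) =
  (fun i j => K' i j * M i j + (K p p)^-1 * (K i p * K j p * M i j)).
  by apply/funext => i; apply/funext => j; rewrite /K'; ring.
rewrite quadratic_formD (quadratic_form_scale M c (K ^~ p)).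
rewrite addr_ge0 //; last first.
  by rewrite mulr_ge0 ?invr_ge0 ?(ltW Kpp) //; case: pM => _; apply.
suff K'm : (#|[pred i | K' i i != 0%R]| < m)%N.
  by case: (IH K' K'm pK' pM) => _; apply.
rewrite -ltnS; apply: leq_trans Km; rewrite ltnS.
rewrite (cardD1 p [pred i | K i i != 0%R]) inE Kp add1n ltnS.
apply/subset_leq_card/fintype.subsetP => i; rewrite !inE => K'i.
apply/andP; split; apply: contraNneq K'i; rewrite /K'.
  by move=> ->; apply/eqP; field.
move=> Ki; case: (pK) => Ks _; rewrite (Ks i p) (psd_diag0 p pK Ki) Ki.
by rewrite mul0r mul0r mulr0 addr0.
Qed.

Lemma psdD K M : psd K -> psd M -> psd (fun i j => K i j + M i j).
Proof.
move=> [Ks Kp] [Ms Mp]; split=> [i j|c]; first by rewrite Ks Ms.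
by rewrite quadratic_formD addr_ge0.
Qed.

Lemma psd1 : psd (fun _ _ => 1).
Proof.
split=> // c; rewrite /quadratic_form.
under eq_bigr do under eq_bigr do rewrite mulr1.
by under eq_bigr do rewrite -mulr_sumr; rewrite -mulr_suml -expr2 sqr_ge0.
Qed.

Lemma psd_prod (J : Type) (s : seq J) (K : J -> I -> I -> R) :
  (forall n, psd (K n)) -> psd (fun i j => \prod_(n <- s) K n i j).
Proof.
move=> pK; elim: s => [|n s IH].
  by under eq_fun do under eq_fun do rewrite big_nil; exact: psd1.
under eq_fun do under eq_fun do rewrite big_cons.
exact: psd_hadamard.
Qed.

(** Products are monotone for the Loewner order on positive semidefinite
    kernels: the factors are exchanged one at a time, and every exchange is a
    Hadamard product of positive semidefinite kernels. *)
Lemma psd_prod_le (J : Type) (s : seq J) (K M : J -> I -> I -> R) :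
  (forall n, psd (K n)) -> (forall n, psd (fun i j => M n i j - K n i j)) ->
  psd (fun i j => \prod_(n <- s) M n i j - \prod_(n <- s) K n i j).
Proof.
move=> pK pMK.
have pM n : psd (M n).
  suff -> : M n = fun i j => K n i j + (M n i j - K n i j) by exact: psdD.
  by apply/funext => i; apply/funext => j; rewrite addrC subrK.
elim: s => [|n s IH].
  under eq_fun do under eq_fun do rewrite !big_nil subrr.
  split=> // c; rewrite /quadratic_form big1 // => i _.
  by rewrite big1 // => j _; rewrite mulr0.
have -> : (fun i j =>
    \prod_(n <- n :: s) M n i j - \prod_(n <- n :: s) K n i j) =
  fun i j => (M n i j - K n i j) * \prod_(n <- s) M n i j +
     K n i j * (\prod_(n <- s) M n i j - \prod_(n <- s) K n i j).
  by apply/funext => i; apply/funext => j; rewrite !big_cons; ring.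
apply: psdD; apply: psd_hadamard => //.
exact: psd_prod.
Qed.

(** The form in which the comparison of products is applied: K n is the Gram
    kernel of the images under an operator with squared norm at most e n ^+ 2,
    and M n is the Gram kernel of the arguments. *)
Lemma quadratic_form_prod_le (J : finType) (K M : J -> I -> I -> R) (e : J -> R)
    c :
  (forall n, psd (K n)) ->
  (forall n, psd (fun i j => e n ^+ 2 * M n i j - K n i j)) ->
  quadratic_form (fun i j => \prod_n K n i j) c <=
    (\prod_n e n) ^+ 2 * quadratic_form (fun i j => \prod_n M n i j) c.
Proof.
move=> pK pMK; rewrite -subr_ge0 -quadratic_form_ZB.
have [_ /(_ c)] := psd_prod_le (index_enum J) pK pMK.
rewrite (_ : (fun i j => _) = fun i j =>
  (\prod_n e n) ^+ 2 * \prod_n M n i j - \prod_n K n i j) //.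
by apply/funext => i; apply/funext => j; rewrite big_split /= prodrXl.
Qed.

End schur_product.

(** * Bounded operators and their Hilbert space tensor products *)

Section hilbert.
Context {R : realType}.

Lemma innerC (V : hilbertType R) (x y : V) : inner x y = inner y x.
Proof. by rewrite hermC expr0 mul1r. Qed.

Lemma innerDl (V : hilbertType R) (x y z : V) :
  inner (x + y) z = inner x z + inner y z.
Proof. exact: linearDl. Qed.

Lemma innerNl (V : hilbertType R) (x y : V) : inner (- x) y = - inner x y.
Proof. exact: linearNl. Qed.

Lemma innerDr (V : hilbertType R) (x y z : V) :
  inner z (x + y) = inner z x + inner z y.
Proof. by rewrite innerC innerDl !(innerC z). Qed.

Lemma innerNr (V : hilbertType R) (x y : V) : inner y (- x) = - inner y x.
Proof. by rewrite innerC innerNl (innerC y). Qed.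

Lemma inner_suml (V : hilbertType R) (I : Type) (r : seq I) (c : I -> R)
    (f : I -> V) (y : V) :
  inner (\sum_(i <- r) c i *: f i) y = \sum_(i <- r) c i * inner (f i) y.
Proof.
rewrite linear_sumlz; apply: eq_bigr => i _; exact: linearZl_LR.
Qed.

Lemma norm_sum_inner (V : hilbertType R) (I : finType) (c : I -> R)
    (f : I -> V) :
  `|\sum_i c i *: f i| ^+ 2 = quadratic_form (fun i j => inner (f i) (f j)) c.
Proof.
rewrite -inner_norm inner_suml; apply: eq_bigr => i _.
rewrite innerC inner_suml mulr_sumr; apply: eq_bigr => j _.
by rewrite innerC mulrA.
Qed.

Lemma polarization (V : hilbertType R) (x y : V) :
  inner x y = 4^-1 * (`|x + y| ^+ 2 - `|x - y| ^+ 2).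
Proof.
rewrite -!inner_norm !innerDl !innerDr !innerNl !innerNr (innerC y x).
by field.
Qed.

Lemma bounded_linear_normP (V W : normedModType R) (T : V -> W) :
  bounded_linear T <->
  linear T /\ exists2 M : R, 0 <= M & forall f, `|T f| <= M * `|f|.
Proof.
split=> -[Tl].
  pose T' : {linear V -> W} := HB.pack T (GRing.isLinear.Build _ _ _ _ T Tl).
  move=> /(linear_bounded_continuous T') /linear_boundedP.
  move=> [M [Mr HM]]; split=> //; exists (Num.max 0 (M + 1)).
    by rewrite le_max lexx.
  by apply: HM; rewrite lt_max (ltrDl M 1) ltr01 orbT.
pose T' : {linear V -> W} := HB.pack T (GRing.isLinear.Build _ _ _ _ T Tl).
move=> [M M0 HM]; split=> //.
apply/(linear_bounded_continuous T')/linear_boundedP.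
exists M; split=> [|r Mr x]; first exact: num_real.
apply: (le_trans (HM x)); rewrite ler_wpM2r //; exact: ltW.
Qed.

Lemma dense_approx (V : normedModType R) (D : set V) (x : V) (e : R) :
  dense D -> 0 < e -> exists2 y, D y & `|x - y| < e.
Proof.
move=> Dd e0; have [y [xy Dy]] : ball x e `&` D !=set0.
  apply: Dd; last exact: ball_open.
  by exists x; exact: ballxx.
by exists y => //; move: xy; rewrite -ball_normE.
Qed.

Lemma bounded_linear_ext (V W : normedModType R) (A B : V -> W) (D : set V) :
  bounded_linear A -> bounded_linear B -> dense D ->
  (forall x, D x -> A x = B x) -> A = B.
Proof.
move=> /bounded_linear_normP[Al [M M0 AM]] /bounded_linear_normP[Bl [N N0 BN]].
move=> Dd AB; apply/funext => x; apply/eqP; rewrite -subr_eq0 -normr_le0.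
have linB T : linear T -> forall u v : V, T (u - v) = T u - T v :> W.
  by move=> Tl u v; rewrite (addrC u) -(scaleN1r v) Tl scaleN1r addrC.
apply/ler_addgt0Pl => e e0; rewrite addr0.
have e'0 : 0 < e / (M + N + 1) by rewrite divr_gt0 // ltr_wpDl // addr_ge0.
have [y Dy xy] := dense_approx x Dd e'0.
have -> : A x - B x = A (x - y) - B (x - y).
  by rewrite !linB // (AB y) // opprB addrA subrK.
apply: (le_trans (ler_normB _ _)); apply: (le_trans (lerD (AM _) (BN _))).
rewrite -mulrDl; apply: (@le_trans _ _ ((M + N) * (e / (M + N + 1)))).
  by rewrite ler_wpM2l ?addr_ge0 // ltW.
rewrite mulrA ler_pdivrMr ?ltr_wpDl ?addr_ge0 //.
rewrite mulrC ler_wpM2l ?ltW //; lra.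
Qed.

(** Extension by continuity, starting from a linear relation Gr instead of a
    map: the bound on Gr makes it single-valued, and its closure is the graph of
    a bounded operator defined everywhere.  This form suits the assignment
    sending a combination of elementary tensors to the combination of their
    images, since a vector has many such representations. *)
Lemma densely_defined_extension (V : normedModType R)
    (W : completeNormedModType R) (Gr : V -> W -> Prop) (M : R) :
  0 <= M ->
  (forall a x y x' y', Gr x y -> Gr x' y' -> Gr (a *: x + x') (a *: y + y')) ->
  (forall x y, Gr x y -> `|y| <= M * `|x|) ->
  dense [set x | exists y, Gr x y] ->
  exists A : V -> W, [/\ linear A, forall x, `|A x| <= M * `|x| &
    forall x y, Gr x y -> A x = y].
Proof.
move=> M0 Glin Gbd Gd.
have GB x y x' y' : Gr x y -> Gr x' y' -> `|y - y'| <= M * `|x - x'|.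
  move=> xy xy'; apply: Gbd.
  rewrite (addrC x) -(scaleN1r x') (addrC y) -(scaleN1r y').
  exact: Glin.
have approx x : exists y : W, forall e : R, 0 < e ->
    exists u v, [/\ Gr u v, `|x - u| < e & `|y - v| < e].
  pose Bs (e : R) := [set v | exists u, Gr u v /\ `|x - u| < e].
  pose Fl := filter_from [set e : R | 0 < e] Bs.
  have FP : ProperFilter Fl.
    apply: filter_from_proper; last first.
      move=> e e0; have [u [v uv] xu] := dense_approx x Gd e0.
      by exists v, u.
    apply: filter_from_filter; first by exists 1 => /=.
    move=> e e' /= e0 e'0; exists (Num.min e e') => /=.
      by rewrite lt_min e0.
    by move=> v [u [uv]]; rewrite lt_min => /andP[? ?]; split; exists u.
  have Fc : cauchy Fl.
    apply: cauchy_exP => e e0.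
    have e'0 : 0 < e / (M + M + 1) by rewrite divr_gt0 // ltr_wpDl // addr_ge0.
    have [u [v uv] xu] := dense_approx x Gd e'0.
    exists v; exists (e / (M + M + 1)) => //= v' [u' [uv' xu']].
    rewrite -ball_normE /=; apply: le_lt_trans (GB _ _ _ _ uv uv') _.
    have uu' : `|u - u'| <= e / (M + M + 1) + e / (M + M + 1).
      rewrite (_ : u - u' = (x - u') - (x - u)); last first.
        by rewrite opprB [RHS]addrC subrKA.
      by apply: (le_trans (ler_normB _ _)); rewrite lerD // ltW.
    apply: (le_lt_trans (ler_wpM2l M0 uu')).
    rewrite (_ : M * _ = (M + M) * e / (M + M + 1)); last by ring.
    rewrite ltr_pdivrMr ?ltr_wpDl ?addr_ge0 // [ltLHS]mulrC ltr_pM2l //.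
    by rewrite ltrDl.
  have [y Fy] : exists y : W, Fl --> y by exists (lim Fl); exact/cauchy_cvgP.
  exists y => e e0.
  have /Fy [e' /= e'0 H] : nbhs y (ball y e) by exact: nbhsx_ballx.
  have [u [v uv] xu] : exists2 u, (exists v, Gr u v) & `|x - u| < Num.min e e'.
    by apply: (dense_approx _ Gd); rewrite lt_min e0.
  exists u, v; move: xu; rewrite lt_min => /andP[xu xu'].
  by split => //; have := H v; rewrite -ball_normE; apply; exists u.
have [A HA] := choice approx.
have AB x u v : Gr u v -> `|A x - v| <= M * `|x - u|.
  move=> uv; apply/ler_addgt0Pl => e e0.
  have e'0 : 0 < e / (M + 1) by rewrite divr_gt0 // ltr_wpDl.
  have [u' [v' [uv' xu' Av']]] := HA x _ e'0.
  rewrite (_ : A x - v = (A x - v') + (v' - v)); last by rewrite addrA subrK.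
  apply: (le_trans (ler_normD _ _)).
  apply: (le_trans (lerD (ltW Av') (GB _ _ _ _ uv' uv))).
  have uu : `|u' - u| <= e / (M + 1) + `|x - u|.
    rewrite (_ : u' - u = (x - u) - (x - u')); last first.
      by rewrite opprB [RHS]addrC subrKA.
    by apply: (le_trans (ler_normB _ _)); rewrite addrC lerD // ltW.
  apply: (le_trans (lerD (lexx _) (ler_wpM2l M0 uu))).
  rewrite mulrDr addrA lerD // (_ : _ + _ = e) //.
  by field; rewrite gt_eqF // ltr_wpDl.
exists A; split.
- move=> a x z; apply/eqP; rewrite -subr_eq0 -normr_le0.
  apply/ler_addgt0Pl => e e0; rewrite addr0.
  (* The total error below is (M + 1) * (`|a| + 1) times the precision of the
     approximations. *)
  pose c := (M + 1) * (`|a| + 1) * 2.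
  have c0 : 0 < c by rewrite !mulr_gt0 // ltr_wpDl.
  have e'0 : 0 < e / c by rewrite divr_gt0.
  have [u [v [uv xu Av]]] := HA x _ e'0.
  have [u' [v' [uv' xu' Av']]] := HA z _ e'0.
  rewrite (_ : _ - _ = (A (a *: x + z) - (a *: v + v')) -
     (a *: (A x - v) + (A z - v'))); last first.
    have -> : a *: (A x - v) + (A z - v') = (a *: A x + A z) - (a *: v + v').
      by rewrite scalerBr addrACA -opprD.
    by rewrite [in RHS]opprB [RHS]addrA subrK.
  have n1 (Z : normedModType R) (p q : Z) : `|p| < e / c -> `|q| < e / c ->
      `|a *: p + q| <= (`|a| + 1) * (e / c).
    move=> pe qe; apply: (le_trans (ler_normD _ _)).
    by rewrite normrZ mulrDl mul1r lerD // ?(ltW qe) // ler_wpM2l // ltW.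
  apply: (le_trans (ler_normB _ _)).
  have := AB (a *: x + z) _ _ (Glin a _ _ _ _ uv uv').
  rewrite (_ : a *: x + z - (a *: u + u') = a *: (x - u) + (z - u'));
    last first.
    by rewrite scalerBr opprD addrACA.
  move=> /le_trans /(_ (ler_wpM2l M0 (n1 _ _ _ xu xu'))) Ale.
  apply: (le_trans (lerD Ale (n1 _ _ _ Av Av'))).
  rewrite (_ : _ + _ = e / 2).
    by rewrite ler_pdivrMr // mulr_natr mulr2n lerDl ltW.
  rewrite /c; field; rewrite !gt_eqF // ltr_wpDl //.
- have [u [v uv] _] := dense_approx 0 Gd ltr01.
  have := Glin (-1) _ _ _ _ uv uv; rewrite !scaleN1r !addNr => G00 x.
  by have := AB x _ _ G00; rewrite !subr0.
- move=> x y xy; apply/eqP; rewrite -subr_eq0 -normr_le0.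
  by rewrite (le_trans (AB _ _ _ xy)) // subrr normr0 mulr0.
Qed.

Section bounded_linear_maps.
Variables (V W : normedModType R).
Implicit Types T : V -> W.

Lemma bounded_linearB T1 T2 : bounded_linear T1 -> bounded_linear T2 ->
  bounded_linear (fun x => T1 x - T2 x).
Proof.
move=> /bounded_linear_normP[Tl [M M0 TM]] /bounded_linear_normP[Sl [N N0 SN]].
apply/bounded_linear_normP; split=> [a x y|].
  by rewrite Tl Sl scalerBr opprD addrACA.
exists (M + N); first exact: addr_ge0.
by move=> f; rewrite (le_trans (ler_normB _ _)) // mulrDl lerD.
Qed.

Lemma bounded_linear0 : bounded_linear (fun _ : V => 0 : W).
Proof.
apply/bounded_linear_normP; split=> [a x y|]; first by rewrite scaler0 addr0.
by exists 0 => // f; rewrite normr0 mul0r.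
Qed.

Lemma linear_lincomb T (I : finType) (c : I -> R) (f : I -> V) : linear T ->
  T (\sum_i c i *: f i) = \sum_i c i *: T (f i).
Proof.
move=> Tl.
pose T' : {linear V -> W} := HB.pack T (GRing.isLinear.Build _ _ _ _ T Tl).
rewrite [LHS](GRing.linear_sum T'); apply: eq_bigr => i _.
exact: (linearZ_LR T').
Qed.

End bounded_linear_maps.

Lemma norm_sum_tensor (d : nat) (F : 'I_d -> hilbertType R)
    (FF : hilbert_tensor F) (I : finType) (c : I -> R)
    (f : I -> forall n, F n) :
  `|\sum_i c i *: tensor FF (f i)| ^+ 2 =
  quadratic_form (fun i j => \prod_(n < d) inner (f i n) (f j n)) c.
Proof.
rewrite norm_sum_inner; apply: eq_bigr => i _; apply: eq_bigr => j _.
by rewrite tensor_inner.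
Qed.

Lemma inner_psd (V : hilbertType R) (I : finType) (f : I -> V) :
  psd (fun i j => inner (f i) (f j)).
Proof.
split=> [i j|c]; first exact: innerC.
by rewrite -norm_sum_inner sqr_ge0.
Qed.

Lemma bounded_inner_psd (V W : hilbertType R) (T : V -> W) (M : R) (I : finType)
    (f : I -> V) : linear T -> (forall x, `|T x| <= M * `|x|) ->
  psd (fun i j => M ^+ 2 * inner (f i) (f j) - inner (T (f i)) (T (f j))).
Proof.
move=> Tl TM; split=> [i j|c]; first by rewrite innerC (innerC (T _)).
rewrite quadratic_form_ZB -!norm_sum_inner -linear_lincomb //.
rewrite subr_ge0 -exprMn.
set x := \sum_i _; rewrite ler_sqr ?nnegrE //.
by rewrite (le_trans _ (TM x)).
Qed.

Section tensor_operators.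
Variables (d : nat) (F G : 'I_d -> hilbertType R).
Variables (FF : hilbert_tensor F) (GG : hilbert_tensor G).

(** The key estimate behind tensor products of operators.  Both squared norms
    are quadratic forms in c whose kernels are products over the coordinates n
    of Gram kernels, and the Gram kernels of the images are dominated by those
    of the arguments.  It makes the tensor product operator well defined and
    bounds its norm at the same time. *)
Lemma sum_tensor_le (I : finType) (c : I -> R) (f : I -> forall n, F n)
    (T : forall n, F n -> G n) (M : 'I_d -> R) :
  (forall n, linear (T n)) -> (forall n x, `|T n x| <= M n * `|x|) ->
  (forall n, 0 <= M n) ->
  `|\sum_i c i *: tensor GG (fun n => T n (f i n))| <=
    (\prod_n M n) * `|\sum_i c i *: tensor FF (f i)|.
Proof.
move=> Tl TM M0; rewrite -ler_sqr ?nnegrE ?mulr_ge0 ?prodr_ge0 //.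
have -> : ((\prod_n M n) * `|\sum_i c i *: tensor FF (f i)|) ^+ 2 =
  (\prod_n M n) ^+ 2 *
    quadratic_form (fun i j => \prod_(n < d) inner (f i n) (f j n)) c.
  by rewrite -(norm_sum_tensor FF) exprMn.
rewrite norm_sum_tensor; apply: quadratic_form_prod_le => n.
  exact: inner_psd.
exact: (bounded_inner_psd _ (Tl n) (TM n)).
Qed.

Lemma tensor_op_exists (T : forall n, F n -> G n) (M : 'I_d -> R) :
  (forall n, linear (T n)) -> (forall n x, `|T n x| <= M n * `|x|) ->
  (forall n, 0 <= M n) ->
  exists A : FF -> GG, [/\ linear A, forall x, `|A x| <= (\prod_n M n) * `|x| &
    forall f, A (tensor FF f) = tensor GG (fun n => T n (f n))].
Proof.
move=> Tl TM M0.
pose Gr (x : FF) (y : GG) := exists (k : nat) (c : 'I_k -> R)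
  (f : 'I_k -> forall n, F n), x = \sum_i c i *: tensor FF (f i) /\
  y = \sum_i c i *: tensor GG (fun n => T n (f i n)).
have [||||A [Al AM Agr]] := @densely_defined_extension FF GG Gr (\prod_n M n).
- exact: prodr_ge0.
- move=> a x y x' y' [k [c [f [-> ->]]]] [k' [c' [f' [-> ->]]]].
  exists (k + k')%N.
  exists (fun i =>
    match fintype.split i with inl j => a * c j | inr j => c' j end).
  exists (fun i => match fintype.split i with inl j => f j | inr j => f' j end).
  have E (j : 'I_k) : fintype.split (lshift k' j) = inl j.
    exact: (unsplitK (inl j)).
  have E' (j : 'I_k') : fintype.split (rshift k j) = inr j.
    exact: (unsplitK (inr j)).
  rewrite !big_split_ord /= !scaler_sumr.
  by split; congr (_ + _); apply: eq_bigr => j _; rewrite ?E ?E' ?scalerA.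
- move=> x y [k [c [f [-> ->]]]]; exact: sum_tensor_le.
- move=> O O0 oO; have [x [Ox [k [c [f E]]]]] := @tensor_dense _ _ _ FF O O0 oO.
  exists x; split=> //=.
  by exists (\sum_i c i *: tensor GG (fun n => T n (f i n))), k, c, f.
exists A; split=> // f; apply: Agr; exists 1%N, (fun=> 1), (fun=> f).
by rewrite !big_ord1 !scale1r.
Qed.

Lemma bounded_linear_tensor_ext (W : normedModType R) (A B : FF -> W) :
  bounded_linear A -> bounded_linear B ->
  (forall f, A (tensor FF f) = B (tensor FF f)) -> A = B.
Proof.
move=> Ab Bb AB; apply: (bounded_linear_ext Ab Bb (@tensor_dense _ _ _ FF)).
move=> x [k [c [f ->]]].
rewrite (linear_lincomb _ _ Ab.1) (linear_lincomb _ _ Bb.1).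
by apply: eq_bigr => i _; rewrite AB.
Qed.

(** [tensor_op] is the operator meant by its definition, and not the default
    value of the choice operator, as soon as such an operator exists. *)
Lemma tensor_opP (T : forall n, F n -> G n) :
  (forall n, bounded_linear (T n)) ->
  bounded_linear (tensor_op FF GG T) /\
  forall f, tensor_op FF GG T (tensor FF f) = tensor GG (fun n => T n (f n)).
Proof.
move=> Tb.
have TM n : exists M, 0 <= M /\ forall x, `|T n x| <= M * `|x|.
  by have /bounded_linear_normP[_ [M M0 TM]] := Tb n; exists M.
have [M HM] := choice TM.
have [||n|A [Al AM AT]] := @tensor_op_exists T M.
- by move=> n; case: (Tb n).
- by move=> n; case: (HM n).
- by case: (HM n).
pose Q := [set A : FF -> GG | bounded_linear A /\
  forall f, A (tensor FF f) = tensor GG (fun n => T n (f n))].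
suff : Q (xget (fun=> 0) Q) by [].
apply: xgetPex; exists A; split=> //; apply/bounded_linear_normP; split=> //.
by exists (\prod_n M n) => //; apply: prodr_ge0 => n _; case: (HM n).
Qed.

Lemma tensor_op_bounded (T : forall n, F n -> G n) :
  (forall n, bounded_linear (T n)) -> bounded_linear (tensor_op FF GG T).
Proof. by case/tensor_opP. Qed.

Lemma tensor_opE (T : forall n, F n -> G n) f :
  (forall n, bounded_linear (T n)) ->
  tensor_op FF GG T (tensor FF f) = tensor GG (fun n => T n (f n)).
Proof. by case/tensor_opP => _ ->. Qed.

Lemma tensor_op_sum (T : forall n, F n -> G n) (I : finType) (c : I -> R)
    (f : I -> forall n, F n) :
  (forall n, bounded_linear (T n)) ->
  tensor_op FF GG T (\sum_i c i *: tensor FF (f i)) =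
  \sum_i c i *: tensor GG (fun n => T n (f i n)).
Proof.
move=> Tb; rewrite linear_lincomb; last by case: (tensor_op_bounded Tb).
by apply: eq_bigr => i _; rewrite tensor_opE.
Qed.

Lemma tensor_op_norm_le (T : forall n, F n -> G n) (M : 'I_d -> R) :
  (forall n, bounded_linear (T n)) -> (forall n x, `|T n x| <= M n * `|x|) ->
  (forall n, 0 <= M n) ->
  forall x, `|tensor_op FF GG T x| <= (\prod_n M n) * `|x|.
Proof.
move=> Tb TM M0.
have [A [Al AM AT]] := tensor_op_exists (fun n => (Tb n).1) TM M0.
suff -> : tensor_op FF GG T = A by [].
apply: bounded_linear_tensor_ext; first exact: tensor_op_bounded.
  apply/bounded_linear_normP; split=> //.
  by exists (\prod_n M n) => //; exact: prodr_ge0.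
by move=> f; rewrite AT tensor_opE.
Qed.

Lemma dfwith_all (A : forall n, F n -> G n) (Q : forall n, (F n -> G n) -> Prop)
    k (B : F k -> G k) : (forall n, Q n (A n)) -> Q k B ->
  forall n, Q n (dfwith A k B n).
Proof. by move=> QA QB n; case: dfwithP. Qed.

(** The only instance of the multilinearity of [tensor_op] that the telescoping
    of the error uses. *)
Lemma tensor_opB (T : forall n, F n -> G n) k (A B : F k -> G k) :
  (forall n, bounded_linear (T n)) -> bounded_linear A -> bounded_linear B ->
  forall x, tensor_op FF GG (dfwith T k (fun y => A y - B y)) x =
    tensor_op FF GG (dfwith T k A) x - tensor_op FF GG (dfwith T k B) x.
Proof.
move=> Tb Ab Bb.
have bd (C : F k -> G k) : bounded_linear C ->
    forall n, bounded_linear (dfwith T k C n).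
  by move=> Cb; exact: (@dfwith_all T (fun n => @bounded_linear R (F n) (G n))).
have ABb := bounded_linearB Ab Bb.
apply/funeqP; apply: bounded_linear_tensor_ext => [||f].
- exact/tensor_op_bounded/bd.
- by apply: bounded_linearB; exact/tensor_op_bounded/bd.
rewrite !tensor_opE //; try exact: bd.
have E (C : F k -> G k) : (fun n => dfwith T k C n (f n)) =
    dfwith (fun n => T n (f n)) k (C (f k)).
  apply: functional_extensionality_dep => n.
  have [kn|kn] := eqVneq k n; last by rewrite !dfwithout.
  by case: _ / kn; rewrite !dfwithin.
have := tensor_multilinear GG (fun n => T n (f n)) (n := k).
rewrite !E /= => ml.
by rewrite (addrC (A (f k))) -(scaleN1r (B (f k))) ml scaleN1r addrC.
Qed.

End tensor_operators.
End hilbert.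

(** * Multi-indices, telescoping and binomial sums *)

Section multi_indices.
Variables d L : nat.
Implicit Type l : {ffun 'I_d -> 'I_L.+1}.

Definition set_index (l : 'I_d -> nat) (k : 'I_d) (m : nat) (n : 'I_d) : nat :=
  if n == k then m else l n.

(** Multi-indices of the first k coordinates.  They are padded by zeros, so that
    all k share one finite type; an entry 0 stands for a coordinate in which the
    solution operator itself is used. *)
Definition prefix_indices (k M : nat) : {pred {ffun 'I_d -> 'I_L.+1}} :=
  fun l => [forall n : 'I_d, (0 < l n)%N == (n < k)%N] && (\sum_n l n <= M)%N.

Lemma sum_set_index (l : 'I_d -> nat) k m : l k = 0%N ->
  (\sum_n set_index l k m n = m + \sum_n l n)%N.
Proof.
move=> lk; rewrite (bigD1 k) //= [in RHS](bigD1 k) //= lk add0n.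
rewrite /set_index eqxx; congr addn; apply: eq_bigr => n /negbTE.
by move->.
Qed.

(** The fibre of the map that forgets the coordinate k: the value m at k ranges
    over what the other entries leave of the total M.+1. *)
Lemma sum_prefix_indicesS (V : nmodType) (t : ('I_d -> nat) -> V) (k : 'I_d) M :
  (M < L)%N ->
  \sum_(l | prefix_indices k.+1 M.+1 l) t (fun n => l n) =
  \sum_(l | prefix_indices k M l)
    \sum_(1 <= m < (M.+1 - \sum_n l n).+1) t (set_index (fun n => l n) k m).
Proof.
move=> ML.
pose z l : {ffun 'I_d -> 'I_L.+1} := [ffun n => if n == k then ord0 else l n].
have Eset (l : {ffun 'I_d -> 'I_L.+1}) (m : 'I_L.+1) :
    (fun n => nat_of_ord ([ffun n => if n == k then m else l n] n)) =
    set_index (fun n => l n) k m.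
  by apply/funext => n; rewrite ffunE /set_index; case: eqP.
have Esum l : (\sum_n l n = l k + \sum_n z l n)%N.
  rewrite (bigD1 k) //= [in RHS](bigD1 k) //= !ffunE eqxx add0n; congr addn.
  by apply: eq_bigr => n /negbTE nk; rewrite ffunE nk.
rewrite (partition_big z (prefix_indices k M)) /=; last first.
  move=> l /andP[/forallP lpos lsum]; apply/andP; split.
    apply/forallP => n; rewrite ffunE; have := lpos n.
    have [->|nk] := eqVneq n k; first by rewrite ltnn.
    by rewrite ltnS (leq_eqVlt n) (negbTE (nk : val n != val k)).
  move: lsum; rewrite Esum; have /eqP := lpos k; rewrite ltnSn.
  case: (nat_of_ord (l k)) => // a _; rewrite addSn ltnS.
  exact: (leq_trans (leq_addl _ _)).
apply: eq_bigr => l' /andP[/forallP lpos lsum].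
have lk : nat_of_ord (l' k) = 0%N.
  by have /eqP := lpos k; rewrite ltnn => /negbT; rewrite -eqn0Ngt => /eqP.
pose h (m : 'I_L.+1) : {ffun 'I_d -> 'I_L.+1} :=
  [ffun n => if n == k then m else l' n].
rewrite (reindex_onto h (fun l => l k)) /=; last first.
  move=> l /andP[_ /eqP El]; apply/ffunP => n; rewrite ffunE -El ffunE.
  by have [->|] := eqVneq n k.
have zh m : z (h m) = l'.
  apply/ffunP => n; rewrite !ffunE; have [->|//] := eqVneq n k.
  by apply: val_inj; rewrite /= lk.
have bL : (M.+1 - \sum_n l' n <= L)%N by exact: (leq_trans (leq_subr _ _)).
rewrite (big_nat_widen _ _ L.+1) ?ltnS // (big_nat_widenl _ 0) // big_mkord.
apply: eq_big => [m|m _]; last by rewrite -Eset.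
rewrite zh eqxx andbT !ffunE eqxx eqxx andbT /prefix_indices.
have -> : (\sum_n h m n = m + \sum_n l' n)%N.
  rewrite Esum zh ffunE eqxx //.
have -> : [forall n, (0 < h m n)%N == (n < k.+1)%N] = (0 < m)%N.
  apply/forallP/idP => [/(_ k)|m0 n]; first by rewrite ffunE eqxx ltnSn => /eqP.
  rewrite ffunE; have [->|nk] := eqVneq n k; first by rewrite m0 ltnSn.
  by rewrite ltnS (leq_eqVlt n) (negbTE (nk : val n != val k)); exact: lpos.
by rewrite [RHS]andbC /= [in RHS]ltnS (leq_subRL _ (leqW lsum)) addnC.
Qed.

Lemma prefix_indices0 M l : prefix_indices 0 M l = (l == [ffun=> ord0]).
Proof.
apply/andP/eqP => [[/forallP l0 _]|->].
  apply/ffunP => n; rewrite ffunE; apply: val_inj => /=.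
  by have /eqP/negbT := l0 n; rewrite -eqn0Ngt => /eqP.
split; first by apply/forallP => n; rewrite ffunE.
by rewrite big1 // => n _; rewrite ffunE.
Qed.

Lemma hockey_stick a N :
  (\sum_(0 <= j < a.+1) 'C(j + N, N) = 'C(a + N.+1, N.+1))%N.
Proof.
elim: a => [|a IH]; first by rewrite big_nat1 !add0n !binn.
by rewrite big_nat_recr //= IH (addSnnS a N) (addSn a) [RHS]binS.
Qed.

(** Counting with a binomial weight on the unused part of the total makes the
    induction on k close: by the hockey-stick identity, summing out the last
    coordinate raises N by one.  The number of multi-indices is the case
    N = 0. *)
Lemma sum_binomial_prefix_indices (k M N : nat) :
  (k <= d)%N -> (M + k <= L)%N ->
  (\sum_(l | prefix_indices k (M + k) l) 'C(M + k - \sum_n l n + N, N) =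
   'C(M + k + N, k + N))%N.
Proof.
elim: k N => [|k IH] N kd ML.
  under eq_bigl do rewrite prefix_indices0.
  rewrite big_pred1_eq big1 ?subn0 // => n _; first by rewrite ffunE.
have := @sum_prefix_indicesS nat
  (fun v : 'I_d -> nat => 'C(M + k.+1 - \sum_n v n + N, N))%N
  (Ordinal kd) (M + k).
rewrite addnS in ML *; move=> /(_ ML) /= E.
apply: (etrans E).
rewrite (addSnnS (M + k) N) (addSnnS k N) -IH; last 2 first.
- exact: ltnW.
- exact: ltnW.
apply: eq_bigr => l /andP[/forallP lpos lsum].
have lk : nat_of_ord (l (Ordinal kd)) = 0%N.
  have /eqP := lpos (Ordinal kd); rewrite ltnn => /negbT.
  by rewrite -eqn0Ngt => /eqP.
under eq_bigr do rewrite sum_set_index //.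
set s := (\sum_n l n)%N in lsum *.
rewrite subSn // -hockey_stick big_add1 /= big_nat_rev /= add0n.
apply: eq_big_nat => i /andP[_ ilt]; congr ('C(_ + N, N)); lia.
Qed.

Lemma card_prefix_indices (k M : nat) : (k <= d)%N -> (M + k <= L)%N ->
  (\sum_(l | prefix_indices k (M + k) l) 1 = 'C(M + k, k))%N.
Proof.
move=> kd ML; have := sum_binomial_prefix_indices 0 kd ML; rewrite !addn0 => <-.
by apply: eq_bigr => l _; rewrite bin0.
Qed.

(** Let T k be the sum of t over the multi-indices of the first k coordinates
    with total at most L - d + k.  Then T 0 is the value at the solution
    operator, T d is the Smolyak sum, and T k - T k.+1 pairs every index l with
    its extensions to the coordinate k. *)
Lemma smolyak_telescope (V : zmodType) (t : ('I_d -> nat) -> V)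
    (r : ('I_d -> nat) -> 'I_d -> nat -> V) :
  (d <= L)%N ->
  (forall v k M, v k = 0%N ->
     t v - \sum_(1 <= m < M.+1) t (set_index v k m) = r v k M) ->
  t (fun=> 0%N) - \sum_(l in Qset L d) t (fun n => l n) =
  \sum_(k < d) \sum_(l | prefix_indices k (L - d + k) l)
     r (fun n => l n) k ((L - d + k).+1 - \sum_n l n)%N.
Proof.
move=> dL tr.
pose Tk k := \sum_(l | prefix_indices k (L - d + k) l) t (fun n => l n).
have -> : t (fun=> 0%N) = Tk 0%N.
  rewrite /Tk; under eq_bigl do rewrite prefix_indices0.
  by rewrite big_pred1_eq; congr t; apply/funext => n; rewrite ffunE.
have -> : \sum_(l in Qset L d) t (fun n => l n) = Tk d.
  apply: eq_bigl => l; rewrite inE subnK //; congr andb.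
  by apply: eq_forallb => n; rewrite ltn_ord eqb_id.
rewrite -opprB -(telescope_sumr _ (leq0n d)) big_mkord -sumrN.
apply: eq_bigr => k _; rewrite opprB /Tk addnS sum_prefix_indicesS; last first.
  by have := ltn_ord k; lia.
rewrite -sumrB; apply: eq_bigr => l /andP[/forallP lpos _].
apply: tr; have /eqP := lpos k; rewrite ltnn => /negbT.
by rewrite -eqn0Ngt => /eqP.
Qed.

End multi_indices.

Section smolyak_bounds.
Context {R : realType}.
Variables (d L : nat) (B C D E : R).
Hypotheses (d_gt0 : (0 < d)%N) (d_le_L : (d <= L)%N).
Hypotheses (B_gt0 : 0 < B) (C_gt0 : 0 < C) (E_gt0 : 0 < E) (D_gt0 : 0 < D).

Definition smolyak_bound := C * B ^+ d.-1 * D ^+ (L - d + 1) *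
    \sum_(0 <= j < d) (E * D / B) ^+ j * ('C(L - d + j, j))%:R.

(** Bounds for the n-th factor of the error term of the index l and position k:
    a detail operator before k, the error of a building block at k, and the
    solution operator after k. *)
Definition term_bound (l : 'I_d -> nat) (k : 'I_d) (n : 'I_d) : R :=
  if (n < k)%N then E * D ^+ l n
  else if n == k then C * D ^+ ((L - d + k).+1 - \sum_n l n) else B.

(** The exponents of D in one product add up to (L - d + k).+1 whatever the
    index is, so the inner sum is a multiple of the number of indices. *)
Lemma sum_term_bound :
  \sum_(k < d)
    \sum_(l : {ffun 'I_d -> 'I_L.+1} | prefix_indices k (L - d + k) l)
      \prod_n term_bound (fun n => l n) k n = smolyak_bound.
Proof.
rewrite /smolyak_bound big_mkord mulr_sumr; apply: eq_bigr => k _.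
transitivity (\sum_(l : {ffun 'I_d -> 'I_L.+1} | prefix_indices k (L - d + k) l)
    (C * E ^+ k * B ^+ (d - k.+1) * D ^+ (L - d + k).+1)).
  apply: eq_bigr => l /andP[/forallP lpos lsum].
  rewrite /term_bound (bigID (fun n : 'I_d => (n < k)%N)) /=.
  rewrite (eq_bigr (fun n => E * D ^+ l n)) => [|n ->] //.
  rewrite big_split /= prodr_const prodrXr.
  have -> : (\sum_(n < d | (n < k)%N) l n = \sum_n l n)%N.
    rewrite [RHS](bigID (fun n : 'I_d => (n < k)%N)) /=.
    rewrite [X in (_ + X)%N]big1 ?addn0 //.
    move=> n nk; have /eqP := lpos n; rewrite (negbTE nk) => /negbT.
    by rewrite -eqn0Ngt => /eqP.
  rewrite [X in _ * X = _](bigD1 k) ?ltnn // eqxx.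
  rewrite (eq_bigr (fun=> B)); last first.
    by move=> n /andP[/negbTE -> /negbTE ->].
  rewrite prodr_const.
  have cardlt j : (j <= d)%N -> #|[pred n : 'I_d | (n < j)%N]| = j.
    move=> jd; rewrite -sum1_card -(big_ord_widen _ (fun=> 1%N)) //.
    by rewrite sum1_card card_ord.
  have -> : #|[pred n : 'I_d | ~~ (n < k)%N && (n != k)]| = (d - k.+1)%N.
    have := cardC [pred n : 'I_d | (n < k.+1)%N].
    rewrite card_ord cardlt // => H.
    suff E1 : #|[pred n : 'I_d | ~~ (n < k)%N && (n != k)]| =
        #|[predC [pred n : 'I_d | (n < k.+1)%N]]|.
      by rewrite E1; apply/eqP; rewrite -(eqn_add2l k.+1) H subnKC.
    apply: eq_card => n; rewrite !inE.
    by rewrite ltnS (leq_eqVlt n) negb_or andbC.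
  rewrite (cardlt k (ltnW (ltn_ord k))).
  have -> : D ^+ (L - d + k).+1 =
      D ^+ (\sum_n l n) * D ^+ ((L - d + k).+1 - \sum_n l n).
    by rewrite -exprD subnKC // leqW.
  by rewrite /=; ring.
have ckL : (L - d + k <= L)%N by have := ltn_ord k; lia.
rewrite (eq_bigr (fun l => (1%N)%:R * (C * E ^+ k * B ^+ (d - k.+1) *
    D ^+ (L - d + k).+1))) => [|l _]; last by rewrite mul1r.
rewrite -mulr_suml -natr_sum (card_prefix_indices (ltnW (ltn_ord k)) ckL).
have -> : B ^+ d.-1 = B ^+ k * B ^+ (d - k.+1).
  by rewrite -exprD; congr (_ ^+ _); have := ltn_ord k; lia.
have -> : D ^+ (L - d + k).+1 = D ^+ (L - d + 1) * D ^+ k.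
  by rewrite -exprD addn1 addSn.
rewrite !expr_div_n exprMn; field.
by rewrite expf_neq0 // gt_eqF.
Qed.

(** Both sides are compared term by term after the hockey-stick identity: up to
    the common factor C * D ^+ L, the j-th term on the left is
    (B / D) ^+ (d.-1 - j) * E ^+ j times a binomial coefficient. *)
Lemma smolyak_bound_le (H := Num.max (B / D) E) :
  smolyak_bound <= C * H ^+ d.-1 * ('C(L, d.-1))%:R * D ^+ L.
Proof.
have H0 : 0 < H by rewrite lt_max E_gt0 orbT.
have -> : 'C(L, d.-1) = (\sum_(0 <= j < d) 'C(L - d + j, j))%N.
  rewrite (eq_bigr (fun j => 'C(j + (L - d), L - d))) => [|j _]; last first.
    by rewrite addnC -[LHS]bin_sub ?leq_addr // addKn.
  have := hockey_stick d.-1 (L - d); rewrite prednK // => ->.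
  by rewrite -[LHS]bin_sub; [congr 'C(_, _); lia|lia].
rewrite natr_sum mulr_sumr mulr_suml /smolyak_bound mulr_sumr.
rewrite !big_mkord; apply: ler_sum => j _.
have -> : D ^+ L = D ^+ (L - d + 1) * D ^+ d.-1.
  by rewrite -exprD; congr (_ ^+ _); lia.
have -> : C * B ^+ d.-1 * D ^+ (L - d + 1) *
    ((E * D / B) ^+ j * 'C(L - d + j, j)%:R) =
  C * (B / D) ^+ (d.-1 - j) * E ^+ j * ('C(L - d + j, j))%:R *
    (D ^+ (L - d + 1) * D ^+ d.-1).
  have -> : D ^+ d.-1 = D ^+ j * D ^+ (d.-1 - j).
    by rewrite -exprD subnKC //; have := ltn_ord j; lia.
  have -> : B ^+ d.-1 = B ^+ j * B ^+ (d.-1 - j).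
    by rewrite -exprD subnKC //; have := ltn_ord j; lia.
  rewrite !expr_div_n exprMn; field.
  by rewrite !expf_neq0 // gt_eqF.
rewrite ler_wpM2r ?mulr_ge0 ?exprn_ge0 ?(ltW D_gt0) //.
rewrite ler_wpM2r // -[leLHS]mulrA ler_wpM2l ?(ltW C_gt0) //.
have -> : H ^+ d.-1 = H ^+ (d.-1 - j) * H ^+ j.
  by rewrite -exprD subnK //; have := ltn_ord j; lia.
have BD0 : 0 <= B / D by rewrite divr_ge0 // ltW.
rewrite ler_pM ?exprn_ge0 ?(ltW E_gt0) //.
- by rewrite lerXn2r ?nnegrE ?(ltW H0) // le_max lexx.
- by rewrite lerXn2r ?nnegrE ?(ltW H0) ?(ltW E_gt0) // le_max lexx orbT.
Qed.

End smolyak_bounds.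

(** * Integrals of products over a product probability space *)

Section has_integral.
Context {dT : measure_display} {T : measurableType dT} {R : realType}.
Variable mu : {measure set T -> \bar R}.
Implicit Types (f g : T -> R) (a b : R).

Definition has_integral f a : Prop :=
  mu.-integrable setT (EFin \o f) /\ (\int[mu]_x (f x)%:E)%E = a%:E.

Lemma has_integral_measurable f a : has_integral f a -> measurable_fun setT f.
Proof. by case=> /integrableP[/measurable_EFinP]. Qed.

Lemma has_integral_uniq f a b : has_integral f a -> has_integral f b -> a = b.
Proof. by move=> [_ fa] [_]; rewrite fa => -[]. Qed.

Lemma has_integralP f : mu.-integrable setT (EFin \o f) ->
  exists a, has_integral f a.
Proof.
move=> fi; exists (fine (\int[mu]_x (f x)%:E)); split=> //.
by rewrite fineK //; exact: (integrable_fin_num measurableT fi).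
Qed.

Lemma has_integral_ge0 f a : has_integral f a -> (forall x, 0 <= f x) -> 0 <= a.
Proof.
move=> [_ fa] f0; rewrite -lee_fin -fa; apply: integral_ge0 => x _.
by rewrite lee_fin.
Qed.

Lemma ge0_has_integral f a : measurable_fun setT f -> (forall x, 0 <= f x) ->
  (\int[mu]_x (f x)%:E)%E = a%:E -> has_integral f a.
Proof.
move=> mf f0 fa; split=> //; apply/integrableP.
split; first exact/measurable_EFinP.
under eq_integral do rewrite /= ger0_norm //.
by rewrite fa ltry.
Qed.

Lemma has_integralZ f a b : has_integral f a ->
  has_integral (fun x => b * f x) (b * a).
Proof.
move=> [fi fa]; split; first exact: (integrableZl measurableT b fi).
under eq_integral do rewrite EFinM.
by rewrite (integralZl measurableT fi) fa.
Qed.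

Lemma has_integralB f g a b : has_integral f a -> has_integral g b ->
  has_integral (fun x => f x - g x) (a - b).
Proof.
move=> [fi fa] [gi gb]; split; first exact: (integrableB measurableT fi gi).
under eq_integral do rewrite EFinB.
by rewrite (integralB_EFin measurableT fi gi) fa gb.
Qed.

Lemma has_integral_sum (I : Type) (s : seq I) (f : I -> T -> R) (a : I -> R) :
  (forall i, has_integral (f i) (a i)) ->
  has_integral (fun x => \sum_(i <- s) f i x) (\sum_(i <- s) a i).
Proof.
move=> fa.
have E : EFin \o (fun x => \sum_(i <- s) f i x) =
    (fun x => (\sum_(i <- s) (f i x)%:E)%E).
  by apply/funext => x /=; rewrite sumEFin.
split.
  rewrite E; apply: (integrable_sum measurableT) => i _; exact: (fa i).1.
transitivity (\int[mu]_x (\sum_(i <- s) (f i x)%:E)%E)%E.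
  by apply: eq_integral => x _; rewrite sumEFin.
rewrite (@integral_sum _ _ _ mu setT measurableT _ (fun i x => (f i x)%:E)).
  by rewrite -sumEFin; apply: eq_bigr => i _; case: (fa i).
by move=> i; case: (fa i).
Qed.

Lemma eq_has_integral f g a : f =1 g -> has_integral f a -> has_integral g a.
Proof. by move=> /funext ->. Qed.

End has_integral.

Section product_integral.
Import HBNNSimple.
Context {R : realType}.

(** One step of Fubini's theorem without iterated integrals: if the measure with
    density X has c times Q as its image under Y, then this identity passes from
    indicators to simple functions and, by monotone convergence, to nonnegative
    functions. *)
Lemma ge0_integral_mul_comp (d1 d2 : measure_display) (T : measurableType d1)
    (S : measurableType d2) (P : {measure set T -> \bar R})
    (Q : {measure set S -> \bar R}) (Y : T -> S) (X : T -> R) (c : R) :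
  measurable_fun setT Y -> measurable_fun setT X -> (forall x, 0 <= X x) ->
  0 <= c ->
  (forall B, measurable B ->
    (\int[P]_x (X x * \1_B (Y x))%:E)%E = (c%:E * Q B)%E) ->
  forall g : S -> R, measurable_fun setT g -> (forall y, 0 <= g y) ->
  (\int[P]_x (X x * g (Y x))%:E)%E = (c%:E * \int[Q]_y (g y)%:E)%E.
Proof.
move=> mY mX X0 c0 XB g mg g0.
have mg' : measurable_fun setT (EFin \o g) by exact/measurable_EFinP.
pose h := nnsfun_approx measurableT mg'.
have hcvg y : (h n y)%:E @[n --> \oo] --> (g y)%:E.
  by apply: cvg_nnsfun_approx => // z _; rewrite lee_fin.
have hnd y : {homo (fun n => h n y) : n m / (n <= m)%N >-> n <= m}.
  by move=> n m nm; have /lefP := nd_nnsfun_approx measurableT mg' nm; apply.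
have step n : (\int[P]_x (X x * h n (Y x))%:E)%E =
    (c%:E * \int[Q]_y (h n y)%:E)%E.
  rewrite integralT_nnsfun sintegralE ge0_mule_fsumr; last first.
    by move=> r; exact: nnsfun_mulemu_ge0.
  transitivity (\int[P]_x (\sum_(r \in range (h n))
      (r * (X x * \1_(h n @^-1` [set r]) (Y x)))%:E))%E.
    apply: eq_integral => x _; rewrite (fimfunE (h n)).
    rewrite fsumEFin //.
    congr EFin; rewrite mulrC; rewrite fsbig_finite //.
    rewrite [RHS]fsbig_finite //.
    by rewrite mulr_suml; apply: eq_bigr => r _; ring.
  have mi r : measurable (h n @^-1` [set r]).
    by rewrite -[X in measurable X]setTI; apply: measurable_funP.
  have mXi r :
      measurable_fun setT (fun x => X x * \1_(h n @^-1` [set r]) (Y x)).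
    apply: measurable_funM => //.
    have mB : measurable_fun setT (\1_(h n @^-1` [set r]) : S -> R).
      exact: measurable_indic.
    exact: (measurableT_comp mB mY).
  rewrite ge0_integral_fsum //; last 2 first.
  - by move=> r; apply/measurable_EFinP; apply: measurable_funM.
  - move=> r x _; rewrite lee_fin.
    have [[y _ <-]|nr] := pselect (range (h n) r).
      by rewrite !mulr_ge0 //.
    by rewrite preimage10 // indic0 mulr0 mulr0.
  apply: eq_fsbigr => r; rewrite inE => -[y _ <-]; set B := h n @^-1` _.
  under eq_integral do rewrite EFinM.
  rewrite ge0_integralZl_EFin //; last 2 first.
  - by move=> x _; rewrite lee_fin mulr_ge0.
  - by apply/measurable_EFinP; exact: mXi.
  by rewrite (XB _ (mi _)) muleCA.
have mYg (f : S -> R) : measurable_fun setT f ->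
    measurable_fun setT (fun x => X x * f (Y x)).
  by move=> mf; apply: measurable_funM => //; exact: measurableT_comp.
transitivity (limn (fun n => \int[P]_x (X x * h n (Y x))%:E))%E.
  rewrite -(monotone_convergence P measurableT); last 3 first.
  - by move=> n; apply/measurable_EFinP/mYg.
  - by move=> n x _; rewrite lee_fin mulr_ge0.
  - by move=> x _ n m nm; rewrite lee_fin ler_wpM2l // hnd.
  apply: eq_integral => x _; apply/esym/cvg_lim => //.
  under eq_fun do rewrite EFinM.
  by rewrite EFinM; apply: cvgeZl.
under eq_fun do rewrite step.
apply: cvg_lim => //; apply: cvgeZl => //.
have -> : (\int[Q]_y (g y)%:E = \int[Q]_y (limn (fun n => (h n y)%:E)))%E.
  by apply: eq_integral => y _; apply/esym/cvg_lim.
apply: cvg_monotone_convergence => //.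
- by move=> n; apply/measurable_EFinP.
- by move=> n y _; rewrite lee_fin.
- by move=> y _ n m nm; rewrite lee_fin hnd.
Qed.

End product_integral.

Section product_space_integral.
Context {R : realType} {d : nat} {dO : 'I_d -> measure_display}.
Context {Omega : forall n, measurableType (dO n)}.
Variable Pn : forall n, probability (Omega n) R.
Variable P : probability (product_space Omega) R.
Hypothesis P_product : is_product_probability Pn P.

Lemma measurable_coordinate n :
  measurable_fun setT (fun w : product_space Omega => w n).
Proof.
move=> _ B mB; rewrite setTI; apply: sub_sigma_algebra.
by exists n, B.
Qed.

Lemma measurable_coordinate_fun n (g : Omega n -> R) :
  measurable_fun setT g ->
  measurable_fun setT (fun w : product_space Omega => g (w n)).
Proof.
by move=> mg; exact: (measurableT_comp mg (@measurable_coordinate n)).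
Qed.

Lemma measurable_prod_coordinates (g : forall n, Omega n -> R) (Q : pred 'I_d) :
  (forall n, measurable_fun setT (g n)) ->
  measurable_fun setT
    (fun w : product_space Omega => \prod_(n | Q n) g n (w n)).
Proof.
move=> mg; rewrite (_ : (fun w => _) = (fun w : product_space Omega =>
    \prod_(n < d) (if Q n then g n (w n) else 1))); last first.
  by apply/funext => w; rewrite [LHS]big_mkcond.
apply: (@measurable_prod _ _ _ _ _ _ (fun n (w : product_space Omega) =>
  if Q n then g n (w n) else 1)) => n _.
by case: (Q n) => //; exact: measurable_coordinate_fun.
Qed.

Let fam := fun n => Omega n -> R.

Lemma prod_dfwith (g : forall n, fam n) k (h : fam k)
    (w : product_space Omega) :
  \prod_(n < d) dfwith g k h n (w n) =
  (\prod_(n < d | n != k) g n (w n)) * h (w k).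
Proof.
rewrite (bigD1 k) //= dfwithin mulrC; congr (_ * _).
by apply: eq_bigr => n nk; rewrite dfwithout // eq_sym.
Qed.

Lemma prod_dfwith_val (e : 'I_d -> R) k (a : R) :
  \prod_(n < d) dfwith e k a n = (\prod_(n < d | n != k) e n) * a.
Proof.
rewrite (bigD1 k) //= dfwithin mulrC; congr (_ * _).
by apply: eq_bigr => n nk; rewrite dfwithout // eq_sym.
Qed.

Lemma dfwith_self (g : forall n, fam n) k : dfwith g k (g k) = g.
Proof. by apply: functional_extensionality_dep => n; case: dfwithP. Qed.

Lemma dfwith_ge0 (g : forall n, fam n) k (h : fam k) n w :
  (n != k -> 0 <= g n w) -> (forall w, 0 <= h w) -> 0 <= dfwith g k h n w.
Proof.
move=> g0 h0; have [E|nk] := eqVneq k n; last first.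
  by rewrite dfwithout // g0 // eq_sym.
by case: _ / E w g0 => w _; rewrite dfwithin.
Qed.

Lemma has_integral_dfwith (g : forall n, fam n) (e : 'I_d -> R) k (h : fam k)
    (a : R) :
  (forall n, has_integral (Pn n) (g n) (e n)) -> has_integral (Pn k) h a ->
  forall n, has_integral (Pn n) (dfwith g k h n) (dfwith e k a n).
Proof.
move=> ge ha n; have [E|kn] := eqVneq k n; last by rewrite !dfwithout.
by case: _ / E; rewrite !dfwithin.
Qed.

(** Induction on the number k of coordinates whose factor is not an indicator:
    for k = 0 the product is the indicator of a box. *)
Lemma ge0_has_integral_prod (g : forall n, fam n) (e : 'I_d -> R) :
  (forall n w, 0 <= g n w) -> (forall n, has_integral (Pn n) (g n) (e n)) ->
  has_integral P (fun w : product_space Omega => \prod_(n < d) g n (w n))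
    (\prod_(n < d) e n).
Proof.
suff step (k : nat) : (k <= d)%N ->
    forall (g : forall n, fam n) (e : 'I_d -> R),
    (forall n w, 0 <= g n w) -> (forall n, has_integral (Pn n) (g n) (e n)) ->
    (forall n : 'I_d, (k <= n)%N -> exists2 B, measurable B & g n = \1_B) ->
    has_integral P (fun w : product_space Omega => \prod_(n < d) g n (w n))
      (\prod_(n < d) e n).
  by move=> g0 ge; apply: (step d) => // n; rewrite leqNgt ltn_ord.
elim: k => [_|k IH kd] {}g {}e g0 ge gB.
  have [B HB] : exists B : forall n, set (Omega n),
      forall n, measurable (B n) /\ g n = \1_(B n).
    pose Q n (B : set (Omega n)) := measurable B /\ g n = \1_B.
    exists (fun n => xget set0 (Q n)) => n; apply: (xgetPex set0 (P := Q n)).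
    by have [B mB gE] := gB n (leq0n n); exists B.
  have mB n : measurable (B n) by case: (HB n).
  have eB n : e n = fine (Pn n (B n)).
    have := (ge n).2; rewrite (HB n).2 integral_indic // setIT => ->.
    by [].
  pose box := [set w : product_space Omega | forall n, B n (w n)].
  have mbox : measurable box.
    rewrite (_ : box =
        \bigcap_(n in setT) [set w : product_space Omega | B n (w n)]).
      apply: fin_bigcap_measurable => // n _.
      by have := measurable_coordinate measurableT (mB n); rewrite setTI.
    by apply/seteqP; split=> w Hw n; [move=> _|]; exact: Hw.
  apply: ge0_has_integral.
  - apply: (measurable_prod_coordinates xpredT) => n.
    exact: has_integral_measurable (ge n).
  - by move=> w; exact: prodr_ge0.
  have -> : (\prod_(n < d) e n)%:E = (\prod_(n < d) Pn n (B n))%E.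
    rewrite (eq_bigr (fun n => (e n)%:E)) ?prodEFin // => n _.
    by rewrite eB fineK // fin_num_measure.
  rewrite -P_product // -/box -[in RHS](setIT box) -integral_indic //.
  apply: eq_integral => w _; congr EFin; rewrite indicE.
  have [wb|/negP wb] := boolP (w \in box).
    rewrite big1 // => n _; rewrite (HB n).2 indicE mem_set //.
    by move: wb; rewrite inE.
  have [n nB] : exists n, ~ B n (w n).
    by apply/existsNP => H; apply: wb; rewrite inE.
  by rewrite (bigD1 n) //= (HB n).2 indicE memNset // mul0r.
pose k' := Ordinal kd.
pose X (w : product_space Omega) := \prod_(n < d | n != k') g n (w n).
pose c := \prod_(n < d | n != k') e n.
have mg n : measurable_fun setT (g n) by exact: has_integral_measurable (ge n).
have e0 n : 0 <= e n by exact: has_integral_ge0 (ge n) (g0 n).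
have XB B : measurable B ->
    (\int[P]_w (X w * \1_B (w k'))%:E)%E = (c%:E * Pn k' B)%E.
  move=> mB; have PB : Pn k' B \is a fin_num by exact: fin_num_measure.
  have hB : has_integral (Pn k') (\1_B : Omega k' -> R) (fine (Pn k' B)).
    apply: ge0_has_integral => //.
    by rewrite integral_indic // setIT fineK.
  have [||n|_] := IH (ltnW kd) (dfwith g k' (\1_B : fam k'))
    (dfwith e k' (fine (Pn k' B))).
  - by move=> n w; apply: dfwith_ge0.
  - exact: has_integral_dfwith.
  - have [E _|kn] := eqVneq k' n.
      by case: _ / E; exists B => //; rewrite dfwithin.
    rewrite dfwithout // leq_eqVlt => /orP[/eqP E|]; last exact: gB.
    by move: kn; rewrite -val_eqE /= E eqxx.
  under eq_integral do rewrite prod_dfwith.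
  by rewrite prod_dfwith_val EFinM fineK.
apply: ge0_has_integral.
- exact: (measurable_prod_coordinates xpredT).
- by move=> w; exact: prodr_ge0.
have X0 w : 0 <= X w by exact: prodr_ge0.
have c0 : 0 <= c by exact: prodr_ge0.
have E := ge0_integral_mul_comp (@measurable_coordinate k')
  (measurable_prod_coordinates (fun n => n != k') mg) X0 c0 XB (mg k') (g0 k').
transitivity (\int[P]_w (X w * g k' (w k'))%:E)%E.
  by apply: eq_integral => w _; rewrite (bigD1 k') //= mulrC.
rewrite E.
rewrite (ge k').2 -EFinM; congr EFin.
by rewrite [RHS](bigD1 k') //= mulrC.
Qed.

(** Factors of arbitrary sign: they are replaced one at a time by the difference
    of their positive and negative parts. *)
Lemma has_integral_prod (g : forall n, fam n) (e : 'I_d -> R) :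
  (forall n, has_integral (Pn n) (g n) (e n)) ->
  has_integral P (fun w : product_space Omega => \prod_(n < d) g n (w n))
    (\prod_(n < d) e n).
Proof.
suff step (k : nat) : (k <= d)%N ->
    forall (g : forall n, fam n) (e : 'I_d -> R),
    (forall n, has_integral (Pn n) (g n) (e n)) ->
    (forall n : 'I_d, (k <= n)%N -> forall w, 0 <= g n w) ->
    has_integral P (fun w : product_space Omega => \prod_(n < d) g n (w n))
      (\prod_(n < d) e n).
  by move=> ge; apply: (step d) => // n; rewrite leqNgt ltn_ord.
elim: k => [_|k IH kd] {}g {}e ge g0.
  by apply: ge0_has_integral_prod => // n; exact: g0.
pose k' : 'I_d := Ordinal kd.
have [a pa] := has_integralP (integrable_funrpos measurableT (ge k').1).
have [b nb] := has_integralP (integrable_funrneg measurableT (ge k').1).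
have step (h : fam k') x : has_integral (Pn k') h x -> (forall w, 0 <= h w) ->
    has_integral P (fun w => \prod_(n < d) dfwith g k' h n (w n))
      (\prod_(n < d) dfwith e k' x n).
  move=> hx h0; apply: IH; first exact: ltnW.
    exact: has_integral_dfwith.
  move=> n kn w; apply: dfwith_ge0 => // nk; apply: g0.
  by rewrite ltn_neqAle kn andbT eq_sym; exact: nk.
have gE : g k' = (fun w => (g k')^\+ w - (g k')^\- w).
  by apply/funext => w; rewrite -[in LHS](funrposBneg (g k')).
have eE : e k' = a - b.
  by apply: (has_integral_uniq (ge k')); rewrite gE; exact: has_integralB.
have := has_integralB (step _ _ pa (@funrpos_ge0 _ _ _))
  (step _ _ nb (@funrneg_ge0 _ _ _)).
rewrite !prod_dfwith_val -mulrBr -eE.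
have -> : \prod_(n < d) e n = (\prod_(n < d | n != k') e n) * e k'.
  by rewrite (bigD1 k') //= mulrC.
apply: eq_has_integral => w; rewrite !prod_dfwith -mulrBr.
rewrite -[RHS]/(\prod_n _) -[in RHS](dfwith_self g k').
by rewrite prod_dfwith [in RHS]gE.
Qed.

End product_space_integral.

(** * Measurability of norms of random vectors and operators *)

Section separable_measurability.
Context {R : realType} {dT : measure_display} {T : measurableType dT}.

Lemma separable_dense_seq (V : normedModType R) : separable V ->
  exists q : nat -> V, forall x (e : R), 0 < e -> exists n, `|x - q n| < e.
Proof.
move=> [D /countable_injP[f finj] Dd].
exists (fun n => xget 0 [set y | D y /\ f y = n]) => x e e0.
have [y Dy xy] := dense_approx x Dd e0; exists (f y).
suff -> : xget 0 [set z | D z /\ f z = f y] = y by [].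
have [Dz fz] := @xgetPex _ 0 [set z | D z /\ f z = f y]
  (ex_intro _ y (conj Dy erefl)).
by apply: finj => //; rewrite inE.
Qed.

Lemma measurable_fun_gt (f : T -> R) :
  (forall r, measurable [set w | r < f w]) -> measurable_fun setT f.
Proof.
move=> H; apply: (measurability _ (RGenOInfty.measurableE R)).
move=> _ [_ [r ->] <-]; rewrite setTI.
rewrite (_ : f @^-1` _ = [set w | r < f w]) //.
by apply/seteqP; split=> w /=; rewrite in_itv /= andbT.
Qed.

Lemma measurable_fun_lt (f : T -> R) :
  (forall r, measurable [set w | f w < r]) -> measurable_fun setT f.
Proof.
move=> H; apply: (measurability _ (RGenInftyO.measurableE R)).
move=> _ [_ [r ->] <-]; rewrite setTI.
by rewrite (_ : f @^-1` _ = [set w | f w < r]).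
Qed.

Lemma measurable_lt_set (f g : T -> R) : measurable_fun setT f ->
  measurable_fun setT g -> measurable [set w | f w < g w].
Proof.
move=> mf mg; have mfg : measurable_fun setT (fun w => g w - f w).
  exact: measurable_funB.
have := mfg measurableT _ (measurable_itv `]0, +oo[); rewrite setTI.
rewrite (_ : _ @^-1` _ = [set w | f w < g w]) //.
by apply/seteqP; split=> w /=; rewrite in_itv /= andbT subr_gt0.
Qed.

Lemma measurable_norm_sub_cst (V : hilbertType R) (X : T -> V) (v : V) :
  measurable_fun setT (X : T -> borel V) ->
  measurable_fun setT (fun w => `|X w - v|).
Proof.
move=> mX; apply: measurable_fun_gt => r.
have oB : open [set x : V | r < `|x - v|].
  rewrite (_ : [set x | _] = (fun x : V => `|x - v|) @^-1` [set y | r < y]) //.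
  apply: open_comp; last exact: open_gt.
  move=> x _.
  apply: (@continuous_comp _ _ _ (fun x : V => x - v) (fun x => `|x|)).
    by apply: cvgB; [exact: cvg_id|exact: cvg_cst].
  exact: norm_continuous.
have : measurable ([set x : V | r < `|x - v|] : set (borel V)).
  exact: sub_sigma_algebra.
by move=> /(mX measurableT); rewrite setTI.
Qed.

(** The difference of two Borel random vectors is reached through a dense
    sequence: the distance of X and Y is the infimum over n of the sum of their
    distances to q n. *)
Lemma measurable_norm_sub (V : hilbertType R) (X Y : T -> V) : separable V ->
  measurable_fun setT (X : T -> borel V) ->
  measurable_fun setT (Y : T -> borel V) ->
  measurable_fun setT (fun w => `|X w - Y w|).
Proof.
move=> /separable_dense_seq[q qd] mX mY; apply: measurable_fun_lt => r.
rewrite (_ : [set w | _] =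
    \bigcup_n [set w | `|X w - q n| + `|Y w - q n| < r]); last first.
  apply/seteqP; split=> w /=.
    move=> XYr; have [n Xn] := qd (X w) ((r - `|X w - Y w|) / 2) ltac:(lra).
    exists n => //=.
    have : `|Y w - q n| <= `|X w - Y w| + `|X w - q n|.
      rewrite (distrC (X w) (Y w)).
      rewrite (_ : Y w - q n = (Y w - X w) + (X w - q n)) ?ler_normD //.
      by rewrite addrA subrK.
    lra.
  move=> [n _] /=; apply: le_lt_trans; rewrite (distrC (Y w)).
  rewrite (_ : X w - Y w = (X w - q n) + (q n - Y w)) ?ler_normD //.
  by rewrite addrA subrK.
apply: bigcupT_measurable => n; apply: measurable_lt_set.
  by apply: measurable_funD; exact: measurable_norm_sub_cst.
exact: measurable_cst.
Qed.

End separable_measurability.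

Section operator_norm.
Context {R : realType}.

Definition real_op_norm (V W : normedModType R) (T : V -> W) : R :=
  fine (op_norm T).

Lemma op_norm_fin (V W : normedModType R) (T : V -> W) : bounded_linear T ->
  op_norm T = (real_op_norm T)%:E.
Proof.
move=> /bounded_linear_normP[Tl [M M0 TM]]; rewrite fineK //.
have M1 : (op_norm T <= M%:E)%E.
  apply: ge_ereal_sup => _ [f /= f1 <-]; rewrite lee_fin (le_trans (TM f)) //.
  by rewrite ler_piMr.
have M2 : (`|T 0|%:E <= op_norm T)%E.
  by apply: ereal_sup_ubound; exists 0 => //; rewrite /unit_ball /= normr0.
rewrite fin_numE; apply/andP; split.
  by rewrite gt_eqF // (lt_le_trans _ M2) // ltNyr.
by rewrite lt_eqF // (le_lt_trans M1) // ltry.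
Qed.

Lemma real_op_norm_ge0 (V W : normedModType R) (T : V -> W) :
  bounded_linear T -> 0 <= real_op_norm T.
Proof.
move=> Tb; rewrite -lee_fin -op_norm_fin //.
apply: le_trans (_ : `|T 0|%:E <= _)%E.
  by rewrite lee_fin.
by apply: ereal_sup_ubound; exists 0 => //; rewrite /unit_ball /= normr0.
Qed.

Lemma linear_scale (V W : normedModType R) (T : V -> W) a x : linear T ->
  T (a *: x) = a *: T x.
Proof.
move=> Tl; have T0 : T 0 = 0.
  by have := Tl (-1) 0 0; rewrite !scaleN1r !addNr.
by have := Tl a x 0; rewrite T0 !addr0.
Qed.

Lemma homogeneous_bound (V W : normedModType R) (T : V -> W) M : linear T ->
  (forall f, `|f| <= 1 -> `|T f| <= M) -> forall f, `|T f| <= M * `|f|.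
Proof.
move=> Tl TM f; have [->|f0] := eqVneq f 0.
  by have := linear_scale 0 0 Tl; rewrite !scale0r => ->; rewrite !normr0 mulr0.
have n0 : 0 < `|f| by rewrite normr_gt0.
have := TM (`|f|^-1 *: f).
rewrite (linear_scale _ _ Tl) !normrZ normfV normr_id.
rewrite mulVf ?gt_eqF // lexx => /(_ isT).
by rewrite mulrC ler_pdivrMr.
Qed.

Lemma real_op_norm_le (V W : normedModType R) (T : V -> W) :
  bounded_linear T -> forall f, `|T f| <= real_op_norm T * `|f|.
Proof.
move=> Tb; apply: homogeneous_bound => [|f f1]; first by case: Tb.
rewrite -lee_fin -op_norm_fin //.
by apply: ereal_sup_ubound; exists f.
Qed.

Lemma real_op_norm_lub (V W : normedModType R) (T : V -> W) M :
  bounded_linear T -> (forall f, `|f| <= 1 -> `|T f| <= M) ->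
  real_op_norm T <= M.
Proof.
move=> Tb TM; rewrite -lee_fin -op_norm_fin //.
by apply: ge_ereal_sup => _ [f /= f1 <-]; rewrite lee_fin TM.
Qed.

Lemma sup_sqr_norm (V W : normedModType R) (T : V -> W) : bounded_linear T ->
  ereal_sup [set (`|T f| ^+ 2)%:E | f in @unit_ball R V] =
  (real_op_norm T ^+ 2)%:E.
Proof.
move=> Tb; have N0 := real_op_norm_ge0 Tb.
apply/eqP; rewrite eq_le; apply/andP; split.
  apply: ge_ereal_sup => _ [f /= f1 <-]; rewrite lee_fin lerXn2r ?nnegrE //.
  by rewrite (le_trans (real_op_norm_le Tb f)) // ler_piMr.
set s := ereal_sup _.
have sup f : `|f| <= 1 -> ((`|T f| ^+ 2)%:E <= s)%E.
  by move=> f1; apply: ereal_sup_ubound; exists f.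
case: s sup => [s| |] sup; last 2 first.
- by rewrite leey.
- by have := sup 0; rewrite normr0 ler01 leeNy_eq => /(_ isT).
have s0 : 0 <= s.
  have := sup 0; rewrite normr0 ler01 lee_fin => /(_ isT); apply: le_trans.
  exact: sqr_ge0.
rewrite lee_fin -(sqr_sqrtr s0) lerXn2r ?nnegrE ?sqrtr_ge0 //.
apply: real_op_norm_lub => // f f1.
rewrite -(ger0_norm (normr_ge0 (T f))) -sqrtr_sqr ler_wsqrtr //.
by have := sup f f1; rewrite lee_fin.
Qed.

(** The norm exceeds r >= 0 exactly if r * `|q n| < `|T w (q n)| for some member
    q n of a dense sequence.  Comparing with r * `|q n| instead of restricting
    to the unit ball makes a dense sequence of the whole space sufficient. *)
Lemma measurable_real_op_norm (dT : measure_display) (S : measurableType dT)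
    (V W : normedModType R) (T : S -> V -> W) : separable V ->
  (forall w, bounded_linear (T w)) ->
  (forall f, measurable_fun setT (fun w => `|T w f|)) ->
  measurable_fun setT (fun w => real_op_norm (T w)).
Proof.
move=> /separable_dense_seq[q qd] Tb mT; apply: measurable_fun_gt => r.
have [r0|r0] := ltP r 0.
  rewrite (_ : [set w | _] = setT) //; apply/seteqP; split=> // w _ /=.
  exact: lt_le_trans (real_op_norm_ge0 (Tb w)).
rewrite (_ : [set w | _] = \bigcup_n [set w | r * `|q n| < `|T w (q n)|]).
  apply: bigcupT_measurable => n; apply: measurable_lt_set => //.
apply/seteqP; split=> w /=; last first.
  move=> [n _] /= rT; have := lt_le_trans rT (real_op_norm_le (Tb w) (q n)).
  have [->|q0] := eqVneq (q n) 0; first by rewrite normr0 !mulr0 ltxx.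
  by rewrite ltr_pM2r // normr_gt0.
move=> rN; apply: contrapT => H.
suff : real_op_norm (T w) <= r by rewrite leNgt rN.
apply: real_op_norm_lub => // f f1.
have N0 := real_op_norm_ge0 (Tb w).
have Hq n : `|T w (q n)| <= r * `|q n|.
  by rewrite leNgt; apply/negP => h; apply: H; exists n.
apply/ler_addgt0Pl => e e0.
have [n qn] := qd f (e / (real_op_norm (T w) + (r + 1)))
  (divr_gt0 e0 (ltr_wpDl N0 (ltr_wpDl r0 ltr01))).
have -> : T w f = T w (f - q n) + T w (q n).
  have := (Tb w).1 1 (f - q n) (q n); rewrite !scale1r => <-.
  by rewrite subrK.
apply: (le_trans (ler_normD _ _)).
apply: (le_trans (lerD (real_op_norm_le (Tb w) _) (Hq n))).
have q1 : `|q n| <= `|f - q n| + 1.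
  have -> : `|q n| = `|- (f - q n) + f| by rewrite opprB subrK.
  by rewrite (le_trans (ler_normD _ _)) // normrN lerD.
apply: (le_trans (lerD (lexx _) (ler_wpM2l r0 q1))).
rewrite mulrDr mulr1 addrA lerD // -mulrDl.
move: qn; rewrite ltr_pdivlMr; last by rewrite ltr_wpDl // ltr_wpDl.
by have := normr_ge0 (f - q n); lra.
Qed.

End operator_norm.

(** * Mean square bounds for sums and tensor products of random operators *)

Section root_mean_square.
Context {R : realType} {dT : measure_display} {T : measurableType dT}.
Variable mu : {measure set T -> \bar R}.

(** The integral of a nonnegative function is a supremum over the simple
    functions below it, which makes it monotone on arbitrary functions; here
    they are suprema over an uncountable ball. *)
Lemma ge0_le_lower_integral (f g : T -> \bar R) :
  (forall w, (0 <= f w)%E) -> (forall w, (f w <= g w)%E) ->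
  (\int[mu]_w f w <= \int[mu]_w g w)%E.
Proof.
move=> f0 fg; have g0 w : (0 <= g w)%E by exact: le_trans (fg w).
rewrite !ge0_integralTE //; apply: ge_ereal_sup => _ [h /= hf <-].
by apply: ereal_sup_ubound; exists h => //= w; exact: le_trans (fg w).
Qed.

Lemma measurable_fun_of_sqr (f : T -> R) : (forall w, 0 <= f w) ->
  measurable_fun setT (fun w => f w ^+ 2) -> measurable_fun setT f.
Proof.
move=> f0 mf; rewrite (_ : f = Num.sqrt \o (fun w => f w ^+ 2)); last first.
  by apply/funext => w /=; rewrite sqrtr_sqr ger0_norm.
apply: measurableT_comp mf; apply: continuous_measurable_fun.
exact: sqrt_continuous.
Qed.

(** Weighted Cauchy-Schwarz inequality.  With weights s i that bound the root
    mean squares of the a i, it integrates to the triangle inequality in L2. *)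
Lemma sqr_sum_le (I : finType) (a s : I -> R) : (forall i, 0 < s i) ->
  (\sum_i a i) ^+ 2 <= \sum_i ((\sum_j s j) / s i) * a i ^+ 2.
Proof.
move=> s0; set S := \sum_j s j; set A := \sum_i a i.
have [i0 _|I0] := pickP (fun _ : I => true); last first.
  by rewrite /A !big_pred0 // expr0n.
have S0 : 0 < S.
  by rewrite /S (bigD1 i0) //= ltr_wpDr // sumr_ge0 // => i _; exact: ltW.
have : 0 <= \sum_i (s i)^-1 * (S * a i - A * s i) ^+ 2.
  by apply: sumr_ge0 => i _; rewrite mulr_ge0 ?sqr_ge0 // invr_ge0 ltW.
rewrite (eq_bigr (fun i =>
    S * ((S / s i) * a i ^+ 2) - 2 * S * A * a i + A ^+ 2 * s i)).
  rewrite big_split sumrB /= -!mulr_sumr -/S -/A => H.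
  rewrite -(ler_pM2l S0); move: H; nra.
by move=> i _; field; rewrite gt_eqF.
Qed.

Lemma integral_sqr_sum_le (I : finType) (a : I -> T -> R) (s : I -> R) :
  (forall i, 0 < s i) -> (forall i, measurable_fun setT (a i)) ->
  (forall i, (\int[mu]_w (a i w ^+ 2)%:E <= (s i ^+ 2)%:E)%E) ->
  (\int[mu]_w ((\sum_i a i w) ^+ 2)%:E <= ((\sum_i s i) ^+ 2)%:E)%E.
Proof.
move=> s0 ma ai; set S := \sum_j s j.
have Si i : 0 <= S / s i by rewrite divr_ge0 ?sumr_ge0 // => *; exact: ltW.
pose h i w := ((S / s i) * a i w ^+ 2)%:E.
have h0 i w : (0 <= h i w)%E by rewrite lee_fin mulr_ge0 // sqr_ge0.
have mh i : measurable_fun setT (h i).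
  apply/measurable_EFinP; apply: measurable_funM; first exact: measurable_cst.
  exact: measurable_funX.
apply: (@le_trans _ _ (\int[mu]_w (\sum_i h i w)%E)%E).
  apply: ge0_le_lower_integral => w; first by rewrite lee_fin sqr_ge0.
  by rewrite sumEFin lee_fin sqr_sum_le.
rewrite ge0_integral_sum //.
apply: (@le_trans _ _ (\sum_i ((S / s i) * s i ^+ 2)%:E)%E).
  apply: lee_sum => i _; rewrite /h; under eq_integral do rewrite EFinM.
  rewrite ge0_integralZl_EFin //; last 2 first.
  - by move=> w _; rewrite lee_fin sqr_ge0.
  - by apply/measurable_EFinP; exact: measurable_funX.
  by rewrite [in leRHS]EFinM; apply: lee_wpmul2l; [rewrite lee_fin|exact: ai].
rewrite sumEFin lee_fin expr2 mulr_sumr ler_sum // => i _.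
by rewrite expr2 mulrA divfK // gt_eqF.
Qed.

Lemma root_le (a : \bar R) (b : R) : (0 <= a)%E -> 0 <= b ->
  (a `^ 2^-1 <= b%:E)%E = (a <= (b ^+ 2)%:E)%E.
Proof.
move=> a0 b0; rewrite poweR12_sqrt // -[in RHS]lee_sqrt ?lee_fin ?sqr_ge0 //.
by rewrite EFin_expe sqrte_sqr gee0_abs // lee_fin.
Qed.

Variables (V W : normedModType R) (I : finType).
Variables (A : I -> T -> V -> W) (s : I -> R).

Lemma randomized_error_sum : (forall i, 0 < s i) ->
  (forall i f, `|f| <= 1 -> measurable_fun setT (fun w => `|A i w f|) /\
    (\int[mu]_w (`|A i w f| ^+ 2)%:E <= (s i ^+ 2)%:E)%E) ->
  (forall f, `|f| <= 1 ->
    (\int[mu]_w (`|\sum_i A i w f| ^+ 2)%:E <= ((\sum_i s i) ^+ 2)%:E)%E).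
Proof.
move=> s0 As f f1.
apply: (@le_trans _ _ (\int[mu]_w ((\sum_i `|A i w f|) ^+ 2)%:E)%E).
  apply: ge0_le_lower_integral => w; first by rewrite lee_fin sqr_ge0.
  by rewrite lee_fin lerXn2r ?nnegrE ?sumr_ge0 // ler_norm_sum.
by apply: integral_sqr_sum_le => // i; case: (As i f f1).
Qed.

Lemma worst_case_error_sum (a : I -> T -> R) : (forall i, 0 < s i) ->
  (forall i w f, `|f| <= 1 -> `|A i w f| <= a i w) ->
  (forall i, measurable_fun setT (a i)) ->
  (forall i, (\int[mu]_w (a i w ^+ 2)%:E <= (s i ^+ 2)%:E)%E) ->
  (\int[mu]_w ereal_sup [set (`|\sum_i A i w f| ^+ 2)%:E | f in @unit_ball R V]
    <= ((\sum_i s i) ^+ 2)%:E)%E.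
Proof.
move=> s0 Aa ma ai; apply: le_trans (integral_sqr_sum_le s0 ma ai).
apply: ge0_le_lower_integral => w.
  apply: le_trans (_ : (`|\sum_i A i w 0| ^+ 2)%:E <= _)%E.
    by rewrite lee_fin sqr_ge0.
  by apply: ereal_sup_ubound; exists 0 => //; rewrite /unit_ball /= normr0.
apply: ge_ereal_sup => _ [f /= f1 <-]; rewrite lee_fin.
have le_a : `|\sum_i A i w f| <= \sum_i a i w.
  by rewrite (le_trans (ler_norm_sum _ _ _)) // ler_sum // => i _; exact: Aa.
by rewrite lerXn2r ?nnegrE // (le_trans _ le_a).
Qed.

End root_mean_square.

Section random_tensor_operators.
Context {R : realType} {d : nat} {F G : 'I_d -> hilbertType R}.
Variables (FF : hilbert_tensor F) (GG : hilbert_tensor G).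
Context {dO : 'I_d -> measure_display}.
Context {Omega : forall n, measurableType (dO n)}.
Variables (Pn : forall n, probability (Omega n) R).
Variable P : probability (product_space Omega) R.
Hypothesis P_product : is_product_probability Pn P.
Variables (T : forall n, Omega n -> F n -> G n) (e : 'I_d -> R).
Arguments T : clear implicits.
Hypothesis (Tb : forall n w, bounded_linear (T n w)).
Hypothesis (mT : forall n f, measurable_fun setT (fun w => `|T n w f|)).

Let TT (w : product_space Omega) := tensor_op FF GG (fun n => T n (w n)).

Let TTb w : bounded_linear (TT w).
Proof. by apply: tensor_op_bounded => n; exact: Tb. Qed.

(** The norm of a tensor product of operators is at most the product of the
    norms, and the norms of the factors are independent. *)
Lemma worst_case_tensor_bound :
  (forall n, separable (F n)) ->
  (forall n,
    (\int[Pn n]_w (real_op_norm (T n w) ^+ 2)%:E <= (e n ^+ 2)%:E)%E) ->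
  exists a : product_space Omega -> R, [/\ measurable_fun setT a,
    forall w f, `|f| <= 1 -> `|TT w f| <= a w &
    (\int[P]_w (a w ^+ 2)%:E <= ((\prod_n e n) ^+ 2)%:E)%E].
Proof.
move=> F_sep Te.
have mN n : measurable_fun setT (fun w => real_op_norm (T n w)).
  exact: (measurable_real_op_norm (F_sep n) (@Tb n) (@mT n)).
have N0 n w : 0 <= real_op_norm (T n w) by exact: real_op_norm_ge0.
exists (fun w => \prod_(n < d) real_op_norm (T n (w n))); split.
- exact: (measurable_prod_coordinates xpredT mN).
- move=> w f f1.
  apply: (le_trans (tensor_op_norm_le GG (fun n => @Tb n (w n))
    (fun n => real_op_norm_le (@Tb n (w n))) (fun n => N0 n (w n)) f)).
  by rewrite ler_piMr // prodr_ge0.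
have Nsq n : has_integral (Pn n) (fun w => real_op_norm (T n w) ^+ 2)
    (fine (\int[Pn n]_w (real_op_norm (T n w) ^+ 2)%:E)).
  apply: ge0_has_integral => [|w|]; [exact: measurable_funX|exact: sqr_ge0|].
  rewrite fineK // ge0_fin_numE ?(le_lt_trans (Te n)) ?ltry //.
  by apply: integral_ge0 => w _; rewrite lee_fin sqr_ge0.
have [_ E] := has_integral_prod P_product Nsq.
under eq_integral do rewrite -prodrXl.
rewrite E lee_fin -prodrXl; apply: ler_prod => n _.
apply/andP; split.
  by apply: has_integral_ge0 (Nsq n) _ => w; exact: sqr_ge0.
by rewrite -lee_fin -(Nsq n).2; exact: Te.
Qed.

Section randomized_case.
Hypothesis Te : forall n f,
  (\int[Pn n]_w (`|T n w f| ^+ 2)%:E <= (e n ^+ 2 * `|f| ^+ 2)%:E)%E.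

(* The mean square of T n w on F n is a quadratic form, and kappa n is its
   polarization. *)
Let kappa n f g : R := fine (\int[Pn n]_w (inner (T n w f) (T n w g))%:E).
Arguments kappa : clear implicits.

Let kappaP n f g :
  has_integral (Pn n) (fun w => inner (T n w f) (T n w g)) (kappa n f g).
Proof.
have sq h : has_integral (Pn n) (fun w => `|T n w h| ^+ 2)
    (fine (\int[Pn n]_w (`|T n w h| ^+ 2)%:E)).
  apply: ge0_has_integral => [|w|]; [exact: measurable_funX|exact: sqr_ge0|].
  rewrite fineK // ge0_fin_numE ?(le_lt_trans (@Te n h)) ?ltry //.
  by apply: integral_ge0 => w _; rewrite lee_fin sqr_ge0.
have [a [ai aE]] : exists a,
    has_integral (Pn n) (fun w => inner (T n w f) (T n w g)) a.
  eexists; apply: eq_has_integral; last first.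
    exact: (has_integralZ 4^-1 (has_integralB (sq (f + g)) (sq (f - g)))).
  move=> w; rewrite polarization.
  have Tl := (@Tb n w).1; have := Tl 1 f g; have := Tl (-1) g f.
  rewrite !scaleN1r !scale1r (addrC _ f) => -> ->.
  by rewrite (addrC (- _) (T n w f)).
by split=> //; rewrite /kappa aE.
Qed.

Let kappa_form n (I : finType) (c : I -> R) (f : I -> F n) :
  has_integral (Pn n) (fun w => `|T n w (\sum_i c i *: f i)| ^+ 2)
    (quadratic_form (fun i j => kappa n (f i) (f j)) c).
Proof.
apply: (@eq_has_integral _ _ _ _ (fun w =>
    \sum_i \sum_j c i * c j * inner (T n w (f i)) (T n w (f j)))).
  by move=> w; rewrite (linear_lincomb _ _ (@Tb n w).1) norm_sum_inner.
apply: has_integral_sum => i; apply: has_integral_sum => j.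
exact/has_integralZ/kappaP.
Qed.

Let kappa_sym n f g : kappa n f g = kappa n g f.
Proof.
apply: (has_integral_uniq (@kappaP n f g)).
apply: eq_has_integral (@kappaP n g f).
by move=> w; rewrite innerC.
Qed.

Let kappa_psd n (I : finType) (f : I -> F n) :
  psd (fun i j => kappa n (f i) (f j)).
Proof.
split=> [i j|c]; first exact: kappa_sym.
by apply: has_integral_ge0 (@kappa_form n I c f) _ => w; exact: sqr_ge0.
Qed.

Let kappa_psd_le n (I : finType) (f : I -> F n) :
  psd (fun i j => e n ^+ 2 * inner (f i) (f j) - kappa n (f i) (f j)).
Proof.
split=> [i j|c]; first by rewrite innerC kappa_sym.
rewrite quadratic_form_ZB -norm_sum_inner subr_ge0 -lee_fin.
rewrite -(@kappa_form n I c f).2; exact: Te.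
Qed.

(* By independence, the mean square on a combination of elementary tensors is
   the quadratic form of the product of the kernels kappa n. *)
Let simple_tensor_bound (I : finType) (c : I -> R) (f : I -> forall n, F n)
    (x := \sum_i c i *: tensor FF (f i)) :
  measurable_fun setT (fun w => `|TT w x|) /\
  (\int[P]_w (`|TT w x| ^+ 2)%:E <= ((\prod_n e n) ^+ 2 * `|x| ^+ 2)%:E)%E.
Proof.
have H : has_integral P (fun w => `|TT w x| ^+ 2)
    (quadratic_form (fun i j => \prod_n kappa n (f i n) (f j n)) c).
  apply: (@eq_has_integral _ _ _ P (fun w : product_space Omega =>
      \sum_i \sum_j c i * c j *
        \prod_(n < d) inner (T n (w n) (f i n)) (T n (w n) (f j n)))).
    move=> w; rewrite /TT /x tensor_op_sum; last by move=> n; exact: Tb.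
    by rewrite (norm_sum_tensor GG c (fun i n => T n (w n) (f i n))).
  apply: has_integral_sum => i; apply: has_integral_sum => j.
  apply: has_integralZ.
  exact: (has_integral_prod P_product (fun n => @kappaP n (f i n) (f j n))).
split.
  apply: measurable_fun_of_sqr => //; exact: has_integral_measurable H.
rewrite H.2 lee_fin norm_sum_tensor.
exact: (quadratic_form_prod_le c (fun n => @kappa_psd n I (f ^~ n))
  (fun n => @kappa_psd_le n I (f ^~ n))).
Qed.

(** In mean square, a tensor product of independent random operators behaves
    like a deterministic one: on combinations of elementary tensors the expected
    Gram kernels take the place of the Gram kernels of the images, and Fatou's
    lemma passes to limits of such combinations. *)
Lemma randomized_tensor_bound x :
  measurable_fun setT (fun w => `|TT w x|) /\
  (\int[P]_w (`|TT w x| ^+ 2)%:E <= ((\prod_n e n) ^+ 2 * `|x| ^+ 2)%:E)%E.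
Proof.
pose Q (m : nat) (u : FF) := `|x - u| < m.+1%:R^-1 /\
  (measurable_fun setT (fun w => `|TT w u|) /\
   (\int[P]_w (`|TT w u| ^+ 2)%:E <= ((\prod_n e n) ^+ 2 * `|u| ^+ 2)%:E)%E).
have [u Hu] : exists u : nat -> FF, forall m, Q m (u m).
  suff /choice[u Hu] : forall m, exists u, Q m u by exists u.
  move=> m.
  have m0 : 0 < m.+1%:R^-1 :> R by rewrite invr_gt0.
  have [_ [k [c [f ->]]] xu] := dense_approx x (@tensor_dense _ _ _ FF) m0.
  by exists (\sum_i c i *: tensor FF (f i)); split=> //;
    exact: simple_tensor_bound.
have u_cvg : u @ \oo --> x.
  apply/cvgrPdist_lt => r r0; near=> m.
  apply: lt_le_trans (Hu m).1 _; apply: ltW.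
  near: m; exact: near_infty_natSinv_lt (PosNum r0).
have TTu w : `|TT w (u m)| @[m --> \oo] --> `|TT w x|.
  apply: cvg_norm; apply: continuous_cvg u_cvg; exact: (TTb w).2.
split.
  by apply: (measurable_fun_cvg (fun m => (Hu m).2.1)) => w _; exact: TTu.
have sqc (h : nat -> R) (l : R) : h @ \oo --> l ->
    (h m ^+ 2)%:E @[m --> \oo] --> (l ^+ 2)%:E.
  by move=> hl; apply: cvg_EFin; [exact: nearW|apply: cvgM].
have -> : (\int[P]_w (`|TT w x| ^+ 2)%:E =
    \int[P]_w limn_einf (fun m => (`|TT w (u m)| ^+ 2)%:E))%E.
  apply: eq_integral => w _; apply/esym.
  by apply: (cvg_limn_einf_sup (sqc _ _ (TTu w))).1.
apply: le_trans (fatou _ _ _ _) _ => //.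
  by move=> m; apply/measurable_EFinP/measurable_funX; exact: (Hu m).2.1.
rewrite limn_einf_lim.
have Klim : ((\prod_n e n) ^+ 2 * `|u m| ^+ 2)%:E @[m --> \oo] -->
    ((\prod_n e n) ^+ 2 * `|x| ^+ 2)%:E.
  under eq_fun do rewrite -exprMn; rewrite -exprMn; apply: sqc.
  by apply: cvgMr; exact: cvg_norm.
apply: lee_cvg_to Klim _; first exact: is_cvg_einfs.
near=> m; apply: le_trans (Hu m).2.2.
by apply: ereal_inf_lbound; exists m => //=.
Unshelve. all: by end_near.
Qed.

End randomized_case.
End random_tensor_operators.

(** * Error norms of sums of tensor products *)

Section tensor_error.
Context {R : realType}.

Definition controlled (dT : measure_display) (S : measurableType dT)
    (Q : probability S R) (x : error_kind) (V W : normedModType R)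
    (T : S -> V -> W) (e : R) : Prop :=
  [/\ forall w, bounded_linear (T w),
      forall f, measurable_fun setT (fun w => `|T w f|) &
      (error_norm Q x T <= e%:E)%E].

Lemma randomized_homogeneous (dT : measure_display) (S : measurableType dT)
    (Q : probability S R) (V W : normedModType R) (T : S -> V -> W) (e : R) :
  0 <= e -> controlled Q randomized T e -> forall f,
  (\int[Q]_w (`|T w f| ^+ 2)%:E <= (e ^+ 2 * `|f| ^+ 2)%:E)%E.
Proof.
move=> e0 [Tb mT Te].
have ball f : `|f| <= 1 -> (\int[Q]_w (`|T w f| ^+ 2)%:E <= (e ^+ 2)%:E)%E.
  move=> f1; rewrite -root_le //; last first.
    by apply: integral_ge0 => w _; rewrite lee_fin sqr_ge0.
  by apply: le_trans Te; apply: ereal_sup_ubound; exists f.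
have hom a f : (\int[Q]_w (`|T w (a *: f)| ^+ 2)%:E =
    (a ^+ 2)%:E * \int[Q]_w (`|T w f| ^+ 2)%:E)%E.
  rewrite -ge0_integralZl_EFin ?sqr_ge0 //; last first.
    by apply/measurable_EFinP; exact: measurable_funX.
  apply: eq_integral => w _; rewrite (linear_scale _ _ (Tb w).1) normrZ exprMn.
  by rewrite real_normK ?num_real // EFinM.
move=> f; have [->|f0] := eqVneq f 0.
  have := hom 0 0; rewrite scale0r => ->.
  by rewrite expr0n /= mul0e normr0 expr0n /= mulr0.
have n0 : 0 < `|f| by rewrite normr_gt0.
have := hom `|f| (`|f|^-1 *: f); rewrite scalerA divff ?gt_eqF // scale1r => ->.
rewrite [in leRHS]mulrC [in leRHS]EFinM; apply: lee_wpmul2l.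
  by rewrite lee_fin sqr_ge0.
by apply: ball; rewrite normrZ normfV normr_id mulVf // gt_eqF.
Qed.

Lemma worst_case_op_norm (dT : measure_display) (S : measurableType dT)
    (Q : probability S R) (V W : normedModType R) (T : S -> V -> W) (e : R) :
  0 <= e -> controlled Q worst_case T e ->
  (\int[Q]_w (real_op_norm (T w) ^+ 2)%:E <= (e ^+ 2)%:E)%E.
Proof.
move=> e0 [Tb mT]; rewrite /error_norm.
under eq_integral do rewrite sup_sqr_norm //.
rewrite root_le //; by apply: integral_ge0 => w _; rewrite lee_fin sqr_ge0.
Qed.

Lemma controlled_cst (dT : measure_display) (S : measurableType dT)
    (Q : probability S R) (x : error_kind) (V W : normedModType R)
    (T : V -> W) (e : R) : bounded_linear T -> (op_norm T <= e%:E)%E ->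
  controlled Q x (fun _ => T) e.
Proof.
move=> Tb Te; have N0 := real_op_norm_ge0 Tb.
have Ne : real_op_norm T <= e by rewrite -lee_fin -op_norm_fin.
have e0 : 0 <= e by exact: le_trans Ne.
have cst_int (a : R) : (\int[Q]_w a%:E = a%:E)%E.
  rewrite integral_cst // -[RHS]mule1; congr (_ * _)%E; exact: probability_setT.
split=> [_|f|] //; case: x => /=.
  apply: ge_ereal_sup => _ [f /= f1 <-].
  rewrite root_le ?cst_int ?lee_fin ?sqr_ge0 // lerXn2r ?nnegrE //.
  by rewrite (le_trans (real_op_norm_le Tb f)) // (le_trans _ Ne) // ler_piMr.
under eq_integral do rewrite sup_sqr_norm //.
by rewrite root_le ?cst_int ?lee_fin ?sqr_ge0 // lerXn2r ?nnegrE.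
Qed.

Variables (d : nat) (F G : 'I_d -> hilbertType R).
Variables (FF : hilbert_tensor F) (GG : hilbert_tensor G).
Variables (dO : 'I_d -> measure_display).
Variables (Omega : forall n, measurableType (dO n)).
Variables (Pn : forall n, probability (Omega n) R).
Variable P : probability (product_space Omega) R.
Hypothesis P_product : is_product_probability Pn P.

(** The analytic core: in both error criteria, error norms are submultiplicative
    on tensor products and subadditive on sums. *)
Lemma error_norm_tensor_sum (x : error_kind) (I : finType)
    (T : I -> forall n, Omega n -> F n -> G n) (e : I -> 'I_d -> R) :
  (forall n, separable (F n)) -> (forall i n, 0 < e i n) ->
  (forall i n, controlled (Pn n) x (T i n) (e i n)) ->
  (error_norm P x (fun (w : product_space Omega) f =>
     (\sum_i tensor_op FF GG (fun n => T i n (w n)) f)%R) <=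
   (\sum_i \prod_n e i n)%:E)%E.
Proof.
move=> F_sep e0 Tc.
have ep i n : 0 <= e i n by exact: ltW.
have s0 i : 0 < \prod_n e i n by exact: prodr_gt0.
have ss0 : 0 <= \sum_i \prod_n e i n by apply: sumr_ge0 => i _; exact: ltW.
have Tb i n w : bounded_linear (T i n w) by case: (Tc i n).
have mT i n f : measurable_fun setT (fun w => `|T i n w f|) by case: (Tc i n).
case: x Tc => Tc /=.
  apply: ge_ereal_sup => _ [f /= f1 <-].
  rewrite root_le //; last first.
    by apply: integral_ge0 => w _; rewrite lee_fin sqr_ge0.
  apply: (@randomized_error_sum _ _ _ P _ _ _
    (fun i (w : product_space Omega) => tensor_op FF GG (fun n => T i n (w n)))
    (fun i => \prod_n e i n)) => // i g g1.
  have [mg gi] := randomized_tensor_bound GG P_product (Tb i) (mT i)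
    (fun n => randomized_homogeneous (ep i n) (Tc i n)) g.
  split=> //; apply: le_trans gi _; rewrite lee_fin ler_piMr ?sqr_ge0 //.
  by rewrite expr_le1.
have a_ex i := worst_case_tensor_bound FF GG P_product (Tb i) (mT i) F_sep
  (fun n => worst_case_op_norm (ep i n) (Tc i n)).
have [a Ha] := choice a_ex.
rewrite root_le //; last first.
  apply: integral_ge0 => w _.
  apply: le_trans
    (_ : (`|\sum_i tensor_op FF GG (fun n => T i n (w n)) 0| ^+ 2)%:E <= _)%E.
    by rewrite lee_fin sqr_ge0.
  by apply: ereal_sup_ubound; exists 0 => //; rewrite /unit_ball /= normr0.
apply: (@worst_case_error_sum _ _ _ P _ _ _ (fun i (w : product_space Omega) =>
    tensor_op FF GG (fun n => T i n (w n))) (fun i => \prod_n e i n) a) => //.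
- by move=> i w f f1; case: (Ha i) => _ H _; exact: H.
- by move=> i; case: (Ha i).
- by move=> i; case: (Ha i).
Qed.

End tensor_error.

(** * Decomposition of the error of the Smolyak method *)

Section smolyak_decomposition.
Context {R : realType}.
Variables (d L : nat) (F G : 'I_d -> hilbertType R).
Variables (FF : hilbert_tensor F) (GG : hilbert_tensor G).
Variables (S : forall n, F n -> G n).
Variables (Omega : 'I_d -> Type) (U : forall n, nat -> Omega n -> F n -> G n).
Arguments S : clear implicits.
Arguments U : clear implicits.
Hypothesis (S_bounded : forall n, bounded_linear (S n)).
Hypothesis (U_bounded : forall n l w, (0 < l)%N -> bounded_linear (U n l w)).
Hypothesis d_le_L : (d <= L)%N.

Definition block (n : 'I_d) (l : nat) (w : Omega n) (f : F n) : G n :=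
  if l is 0 then 0 else U n l w f.

(** The factors of the partial Smolyak sums, with index 0 for the solution
    operator as in [prefix_indices]. *)
Definition factor (n : 'I_d) (l : nat) (w : Omega n) : F n -> G n :=
  if l is 0 then S n else difference (U n) l w.

Definition smolyak_term (v : 'I_d -> nat) (k : 'I_d) (m : nat) (n : 'I_d)
    (w : Omega n) : F n -> G n :=
  if n == k then fun f => S n f - block m w f else factor (v n) w.

Lemma block_bounded n l (w : Omega n) : bounded_linear (block l w).
Proof. by case: l => [|l]; [exact: bounded_linear0|exact: U_bounded]. Qed.

Lemma factor_bounded n l (w : Omega n) : bounded_linear (factor l w).
Proof.
case: l => [|l]; first exact: S_bounded.
exact: (bounded_linearB (block_bounded l.+1 w) (block_bounded l w)).
Qed.

(** For every index l and position k, the Smolyak sum refines the factor S k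
    into the details up to some level m, whose sum is the building block of
    index m; what is left of the factor is S k minus this block. *)
Lemma smolyak_errorE (w : forall n, Omega n) (x : FF) :
  tensor_op FF GG S x - smolyak FF GG U L w x =
  \sum_(k < d)
    \sum_(l : {ffun 'I_d -> 'I_L.+1} | prefix_indices k (L - d + k) l)
    tensor_op FF GG (fun n => smolyak_term (fun n => l n) k
      ((L - d + k).+1 - \sum_n l n) (w n)) x.
Proof.
pose t (v : 'I_d -> nat) := tensor_op FF GG (fun n => factor (v n) (w n)) x.
pose r v k m := tensor_op FF GG (fun n => smolyak_term v k m (w n)) x.
have -> : smolyak FF GG U L w x = \sum_(l in Qset L d) t (fun n => l n).
  apply: eq_bigr => l; rewrite inE => /andP[/forallP lpos _]; rewrite /t.
  congr (tensor_op FF GG _ x); apply: functional_extensionality_dep => n.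
  by rewrite /factor; have := lpos n; case: (nat_of_ord (l n)).
apply: (smolyak_telescope (t := t) (r := r)) => // v k M vk.
pose fam n := factor (v n) (w n).
have famb n : bounded_linear (fam n) by exact: factor_bounded.
have rE m : r v k m =
    tensor_op FF GG (dfwith fam k (fun f => S k f - block m (w k) f)) x.
  rewrite /r; congr (tensor_op FF GG _ x).
  apply: functional_extensionality_dep => n; rewrite /smolyak_term.
  have [E|nk] := eqVneq n k; last by rewrite dfwithout // eq_sym.
  by case: _ / (esym E); rewrite dfwithin.
have tE m : t (set_index v k m) =
    tensor_op FF GG (dfwith fam k (factor m (w k))) x.
  rewrite /t; congr (tensor_op FF GG _ x).
  apply: functional_extensionality_dep => n; rewrite /set_index.
  have [E|nk] := eqVneq n k; last by rewrite dfwithout // eq_sym.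
  by case: _ / (esym E); rewrite dfwithin.
elim: M => [|M IH].
  rewrite big_geq // subr0 rE; congr (tensor_op FF GG _ x).
  apply: functional_extensionality_dep => n; case: dfwithP => //.
  by rewrite vk; apply/funext => f; rewrite subr0.
rewrite big_nat_recr //= opprD addrA IH tE !rE.
rewrite -tensor_opB //; last 2 first.
- exact: (bounded_linearB (@S_bounded k) (block_bounded M (w k))).
- exact: factor_bounded.
congr (tensor_op FF GG (dfwith fam k _) x); apply/funext => f.
rewrite -[factor _ _ _]/(block M.+1 (w k) f - block M (w k) f).
by rewrite opprB addrA subrK.
Qed.

End smolyak_decomposition.

(** * Error bounds for the randomized Smolyak method *)

Theorem theorem3 (R : realType) (d L : nat) (d_gt0 : (0 < d)%N)
  (d_le_L : (d <= L)%N)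
  (* separable Hilbert spaces F n of real-valued functions on X n, where
     [ev n f] is the function f, and separable Hilbert spaces G n *)
  (F G : 'I_d -> hilbertType R)
  (F_sep : forall n, separable (F n)) (G_sep : forall n, separable (G n))
  (X : 'I_d -> Type) (ev : forall n, F n -> X n -> R)
  (ev_linear : forall n x, linear (fun f => ev n f x : R^o))
  (ev_inj : forall n, injective (ev n))
  (FF : hilbert_tensor F) (GG : hilbert_tensor G)
  (S : forall n, F n -> G n) (S_bounded : forall n, bounded_linear (S n))
  (dO : 'I_d -> measure_display) (Omega : forall n, measurableType (dO n))
  (Pn : forall n, probability (Omega n) R)
  (P : probability (product_space Omega) R)
  (P_product : is_product_probability Pn P)
  (U : forall n, nat -> Omega n -> F n -> G n)
  (U_randomized : forall n l, (0 < l)%N -> randomized_operator (U n l))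
  (x : error_kind) (B C D E : R)
  (B_gt0 : 0 < B) (C_gt0 : 0 < C) (E_gt0 : 0 < E)
  (D_gt0 : 0 < D) (D_lt1 : D < 1)
  (S_le : forall n, (op_norm (S n) <= B%:E)%E)
  (U_error : forall n l, (0 < l)%N ->
    (error (Pn n) x (S n) (U n l) <= (C * D ^+ l)%:E)%E)
  (r_L2 : x = randomized -> forall n l (f : F n), (0 < l)%N ->
    square_integrable (Pn n) (fun w => U n l w f))
  (w_L2 : x = worst_case -> forall n l, (0 < l)%N ->
    let mu (w : Omega n) := op_norm (U n l w) in
    [/\ forall w, (mu w < +oo)%E,
        measurable_fun setT mu &
        (\int[Pn n]_w (mu w ^+ 2) < +oo)%E])
  (Delta_le : forall n l, (0 < l)%N ->
    (error_norm (Pn n) x (difference (U n) l) <= (E * D ^+ l)%:E)%E) :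
  let bound := C * B ^+ d.-1 * D ^+ (L - d + 1) *
    \sum_(0 <= j < d) (E * D / B) ^+ j * ('C(L - d + j, j))%:R in
  let H := Num.max (B / D) E in
  (error P x (tensor_op FF GG S)
     (fun w : product_space Omega => smolyak FF GG U L w) <= bound%:E)%E /\
  bound <= C * H ^+ d.-1 * ('C(L, d.-1))%:R * D ^+ L.
Proof.
move=> bound H; split; last exact: smolyak_bound_le.
(* The error terms are indexed by the pairs (k, l) in idx, and [enum_val] makes
   these pairs a finite type. *)
pose idx := [pred p : 'I_d * {ffun 'I_d -> 'I_L.+1} |
  prefix_indices p.1 (L - d + p.1) p.2].
pose level (p : 'I_d * {ffun 'I_d -> 'I_L.+1}) : nat :=
  ((L - d + p.1).+1 - \sum_n p.2 n)%N.
pose T (i : 'I_#|idx|) n (w : Omega n) : F n -> G n :=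
  let p := enum_val i in smolyak_term S U (fun n => p.2 n) p.1 (level p) w.
pose e (i : 'I_#|idx|) := let p := enum_val i in
  term_bound L B C D E (fun n => p.2 n) p.1.
have U_bd n l w : (0 < l)%N -> bounded_linear (U n l w).
  by move=> l0; case: (U_randomized n l l0).
have U_meas n l f : measurable_fun setT (fun w => block U l w f : borel (G n)).
  case: l => [|l]; first exact: measurable_cst.
  by case: (U_randomized n l.+1 isT) => _; apply.
have -> : bound = \sum_i \prod_n e i n.
  rewrite -[bound]/(smolyak_bound d L B C D E) -sum_term_bound //.
  rewrite pair_big_dep /=; exact: (@big_enum_val _ _ _ _ idx).
have -> : error P x (tensor_op FF GG S)
     (fun w : product_space Omega => smolyak FF GG U L w) =
   error_norm P x (fun (w : product_space Omega) f =>
     \sum_i tensor_op FF GG (fun n => T i n (w n)) f).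
  rewrite /error; congr error_norm; apply/funext => w; apply/funext => f.
  rewrite smolyak_errorE // pair_big_dep /=.
  exact: (@big_enum_val _ _ _ _ idx).
apply: (error_norm_tensor_sum FF GG P_product F_sep) => [i n|i n].
  by rewrite /e /term_bound; case: ifP => _; [|case: ifP => _];
    rewrite ?mulr_gt0 ?exprn_gt0.
rewrite /T /e; have := enum_valP i; set p := enum_val i; rewrite inE.
move=> /andP[/forallP p_pos p_sum].
have level_gt0 : (0 < level p)%N by rewrite subn_gt0 ltnS.
rewrite /smolyak_term /term_bound.
have [-> /=|np] := eqVneq n p.1.
  rewrite ltnn; split.
  - move=> w.
    exact: (bounded_linearB (S_bounded _) (block_bounded U_bd _ _)).
  - move=> f; rewrite (_ : (fun w => _) =
        (fun w => `|block U (level p) w f - S p.1 f|)); last first.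
      by apply/funext => w; rewrite (distrC (S p.1 f)).
    exact: measurable_norm_sub_cst.
  - have := U_error p.1 (level p) level_gt0; rewrite /error.
    by move: level_gt0; rewrite /block /level; case: (_ - _)%N.
have := p_pos n; case: (nat_of_ord (p.2 n)) => [|l] /eqP.
  move=> /esym/negbT; rewrite -leqNgt => pn; rewrite ltnNge pn /=.
  exact: controlled_cst.
move=> <-; split.
- move=> w; exact: factor_bounded.
- move=> f; apply: measurable_norm_sub => //.
    exact: (U_meas n l.+1 f).
  exact: (U_meas n l f).
- exact: Delta_le.
Qed.
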